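(* Let $(M,h,\mathfrak{g}_\varphi)$ be the real metric calculus over the noncommutative 3-sphere $S^3_\theta$ described in the context, with basis $E_1,E_2,E_3$ of $M$ and $\varphi(\partial_a)=E_a$. There exists a (unique) affine connection $\nabla$ on $(M,\mathfrak{g})$ such that $(M,h,\mathfrak{g}_\varphi,\nabla)$ is a real pseudo-Riemannian calculus. Writing $\nabla_a=\nabla_{\partial_a}$, the connection is given by $$\nabla_1E_1=-E_3,\quad \nabla_1E_2=0,\quad \nabla_1E_3=E_1|W|^2,$$ $$\nabla_2E_1=0,\quad \nabla_2E_2=E_3,\quad \nabla_2E_3=-E_2|Z|^2,$$ $$\nabla_3E_1=E_1|W|^2,\quad \nabla_3E_2=-E_2|Z|^2,\quad \nabla_3E_3=E_3(|W|^2-|Z|^2).$$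
   Context: General definitions. $\mathcal{A}$ is a unital $*$-algebra over $\mathbb{C}$. A derivation $d$ of $\mathcal{A}$ is hermitian if $d(a^* )^*=d(a)$ for all $a$; an element $a$ is hermitian if $a^*=a$. A hermitian form on a right $\mathcal{A}$-module $M$ is a map $h:M\times M\to\mathcal{A}$ with $h(U,V+W)=h(U,V)+h(U,W)$, $h(U,Va)=h(U,V)a$, $h(U,V)^*=h(V,U)$; it is a metric if it is non-degenerate ($h(U,V)=0$ for all $V$ implies $U=0$). For a real Lie algebra $\mathfrak{g}$ of hermitian derivations, an affine connection on $(M,\mathfrak{g})$ is a map $\nabla:\mathfrak{g}\times M\to M$, additive in $M$, $\mathbb{R}$-linear in $\mathfrak{g}$, with $\nabla_d(Ua)=(\nabla_dU)a+Ud(a)$. Given a metric $h$ on $M$ and an $\mathbb{R}$-linear map $\varphi:\mathfrak{g}\to M$, write $\mathfrak{g}_\varphi=(\mathfrak{g},\varphi)$, $M_\varphi=\varphi(\mathfrak{g})$; $(M,h,\mathfrak{g}_\varphi)$ is a real metric calculus if $M_\varphi$ generates $M$ as an $\mathcal{A}$-module and $h(E,E')$ is hermitian for all $E,E'\in M_\varphi$. $(M,h,\mathfrak{g}_\varphi,\nabla)$ is a pseudo-Riemannian calculus if in addition $\nabla$ is an affine connection on $(M,\mathfrak{g})$ with: $h(\nabla_dE,E')$ hermitian for all $d\in\mathfrak{g}$, $E,E'\in M_\varphi$; $d(h(U,V))=h(\nabla_dU,V)+h(U,\nabla_dV)$ for all $d\in\mathfrak{g}$, $U,V\in M$ (metric);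 $\nabla_{d_1}\varphi(d_2)-\nabla_{d_2}\varphi(d_1)-\varphi([d_1,d_2])=0$ for all $d_1,d_2\in\mathfrak{g}$ (torsion-free). It is real if moreover $h(\nabla_{d_1}\nabla_{d_2}E,E')$ is hermitian for all $d_1,d_2\in\mathfrak{g}$, $E,E'\in M_\varphi$. The noncommutative 3-sphere. Let $\theta\in\mathbb{R}$, $q=e^{2\pi i\theta}$. $S^3_\theta$ is the unital $*$-algebra over $\mathbb{C}$ generated by $Z,Z^*,W,W^*$ subject to $WZ=qZW$, $W^*Z=\bar qZW^*$, $WZ^*=\bar qZ^*W$, $W^*Z^*=qZ^*W^*$, $Z^*Z=ZZ^*$, $W^*W=WW^*$, $WW^*=\mathbf{1}-ZZ^*$. Set $|Z|^2=ZZ^*$, $|W|^2=WW^*$ (central elements), $X^1=\frac12(Z+Z^* )$, $X^2=\frac1{2i}(Z-Z^* )$, $X^3=\frac12(W+W^* )$, $X^4=\frac1{2i}(W-W^* )$. $M$ is the right submodule of the free module $(S^3_\theta)^4$ generated by $E_1=(-X^2,X^1,0,0)$, $E_2=(0,0,-X^4,X^3)$, $E_3=(X^1|W|^2,X^2|W|^2,-X^3|Z|^2,-X^4|Z|^2)$; it is free with basis $E_1,E_2,E_3$. For $U=\sum_aE_aU^a$, $V=\sum_aE_aV^a$, $h(U,V)=\sum_{a,b=1}^3(U^a)^*h_{ab}V^b$ with $(h_{ab})=\mathrm{diag}(|Z|^2,|W|^2,|Z|^2|W|^2)$. $\partial_1,\partial_2,\partial_3$ are the (commuting) hermitian derivations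 of $S^3_\theta$ determined by $\partial_1Z=iZ$, $\partial_1W=0$; $\partial_2Z=0$, $\partial_2W=iW$; $\partial_3Z=Z|W|^2$, $\partial_3W=-W|Z|^2$. $\mathfrak{g}$ is the (abelian) real Lie algebra generated by $\partial_1,\partial_2,\partial_3$, and $\varphi:\mathfrak{g}\to M$ is the $\mathbb{R}$-linear map with $\varphi(\partial_a)=E_a$. *)

(* Defs.v *)
From HB Require Import structures.
From mathcomp Require Import all_boot all_order all_algebra.
From mathcomp Require Import all_classical all_reals all_analysis.
From mathcomp Require Import complex.

Set Implicit Arguments.
Unset Strict Implicit.
Unset Printing Implicit Defensive.

Import GRing.Theory Num.Theory.
Local Open Scope ring_scope.
Local Open Scope quotient_scope.

HB.mixin Record isStarAlgebra (R : rcfType) (A : Type) of GRing.Algebra R[i] A := {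
  star : A -> A;
  starK : involutive star;
  starD : {morph star : a b / a + b};
  starM : forall a b : A, star (a * b) = star b * star a;
  starZ : forall (c : R[i]) (a : A), star (c *: a) = conjc c *: star a
}.

#[short(type="starAlgType")]
HB.structure Definition StarAlgebra (R : rcfType) :=
  {A of isStarAlgebra R A & GRing.Algebra R[i] A}.

Definition hermitian (R : rcfType) (A : starAlgType R) (a : A) : Prop :=
  star a = a.

Definition derivation (R : rcfType) (A : starAlgType R) (d : A -> A) : Prop :=
  (forall (c : R[i]) (a b : A), d (c *: a + b) = c *: d a + d b) /\
  (forall a b : A, d (a * b) = d a * b + a * d b).

Definition hermitian_der (R : rcfType) (A : starAlgType R) (d : A -> A) : Prop :=
  forall a : A, star (d (star a)) = d a.

Definition der_lin (R : rcfType) (A : starAlgType R) (r : R) (d d' : A -> A) :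
  A -> A := fun a => (r%:C)%C *: d a + d' a.

Definition der_bracket (R : rcfType) (A : starAlgType R) (d d' : A -> A) :
  A -> A := fun a => d (d' a) - d' (d a).

(* A real Lie algebra of hermitian derivations: a real Lie subalgebra of Der(A)
   all of whose members are hermitian. *)
Record herm_lie (R : rcfType) (A : starAlgType R) := HermLie {
  lie_set :> (A -> A) -> Prop;
  lie_setP : forall d, lie_set d -> derivation d /\ hermitian_der d;
  lie_set0 : lie_set (fun=> 0);
  lie_set_lin : forall (r : R) d d',
    lie_set d -> lie_set d' -> lie_set (der_lin r d d');
  lie_set_bracket : forall d d',
    lie_set d -> lie_set d' -> lie_set (der_bracket d d')
}.

Definition lie_elt (R : rcfType) (A : starAlgType R) (g : herm_lie A) : Type :=
  {d : A -> A | g d}.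

Definition lie_lin (R : rcfType) (A : starAlgType R) (g : herm_lie A)
    (r : R) (d d' : lie_elt g) : lie_elt g :=
  exist _ _ (lie_set_lin r (proj2_sig d) (proj2_sig d')).

Definition lie_bracket (R : rcfType) (A : starAlgType R) (g : herm_lie A)
    (d d' : lie_elt g) : lie_elt g :=
  exist _ _ (lie_set_bracket (proj2_sig d) (proj2_sig d')).

(* Right A-modules are left modules over the converse ring A^c, and U *r a is
   the right action of a on U. *)
Definition ract (R : rcfType) (A : starAlgType R) (M : lmodType A^c)
  (U : M) (a : A) : M := (a : A^c) *: U.
Notation "U *r a" := (ract U a) (at level 40, left associativity).

Definition rscale (R : rcfType) (A : starAlgType R) (M : lmodType A^c)
  (r : R) (U : M) : M := U *r (r%:C)%C%:A.

Definition hermitian_form (R : rcfType) (A : starAlgType R) (M : lmodType A^c)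
    (h : M -> M -> A) : Prop :=
  [/\ forall U V W : M, h U (V + W) = h U V + h U W,
      forall (U V : M) (a : A), h U (V *r a) = h U V * a
    & forall U V : M, star (h U V) = h V U].

Definition is_metric (R : rcfType) (A : starAlgType R) (M : lmodType A^c)
    (h : M -> M -> A) : Prop :=
  hermitian_form h /\ forall U : M, (forall V : M, h U V = 0) -> U = 0.

Definition affine_connection (R : rcfType) (A : starAlgType R)
    (M : lmodType A^c) (g : herm_lie A) (nabla : lie_elt g -> M -> M) : Prop :=
  [/\ forall d (U V : M), nabla d (U + V) = nabla d U + nabla d V,
      forall (r : R) d d' (U : M),
        nabla (lie_lin r d d') U = rscale r (nabla d U) + nabla d' U
    & forall d (U : M) (a : A),
        nabla d (U *r a) = nabla d U *r a + U *r proj1_sig d a].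

Definition real_linear (R : rcfType) (A : starAlgType R) (M : lmodType A^c)
    (g : herm_lie A) (phi : lie_elt g -> M) : Prop :=
  forall (r : R) d d', phi (lie_lin r d d') = rscale r (phi d) + phi d'.

Definition generates (R : rcfType) (A : starAlgType R) (M : lmodType A^c)
    (g : herm_lie A) (phi : lie_elt g -> M) : Prop :=
  forall U : M, exists (n : nat) (d : 'I_n -> lie_elt g) (a : 'I_n -> A),
    U = \sum_(k < n) phi (d k) *r a k.

Definition real_metric_calculus (R : rcfType) (A : starAlgType R)
    (M : lmodType A^c) (h : M -> M -> A) (g : herm_lie A)
    (phi : lie_elt g -> M) : Prop :=
  [/\ is_metric h, real_linear phi, generates phi
    & forall d d', hermitian (h (phi d) (phi d'))].

Definition pseudo_riemannian_calculus (R : rcfType) (A : starAlgType R)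
    (M : lmodType A^c) (h : M -> M -> A) (g : herm_lie A)
    (phi : lie_elt g -> M) (nabla : lie_elt g -> M -> M) : Prop :=
  [/\ real_metric_calculus h phi,
      affine_connection nabla,
      forall d e e', hermitian (h (nabla d (phi e)) (phi e')),
      forall d (U V : M),
        proj1_sig d (h U V) = h (nabla d U) V + h U (nabla d V)
    & forall d1 d2,
        nabla d1 (phi d2) - nabla d2 (phi d1) - phi (lie_bracket d1 d2) = 0].

Definition real_pseudo_riemannian_calculus (R : rcfType) (A : starAlgType R)
    (M : lmodType A^c) (h : M -> M -> A) (g : herm_lie A)
    (phi : lie_elt g -> M) (nabla : lie_elt g -> M -> M) : Prop :=
  pseudo_riemannian_calculus h phi nabla /\
  forall d1 d2 e e', hermitian (h (nabla d1 (nabla d2 (phi e))) (phi e')).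

Inductive lie_gen_set (R : rcfType) (A : starAlgType R) (S : (A -> A) -> Prop) :
    (A -> A) -> Prop :=
| LieGen d : S d -> lie_gen_set S d
| LieZero : lie_gen_set S (fun=> 0)
| LieLin (r : R) d d' :
    lie_gen_set S d -> lie_gen_set S d' -> lie_gen_set S (der_lin r d d')
| LieBracket d d' :
    lie_gen_set S d -> lie_gen_set S d' -> lie_gen_set S (der_bracket d d').

Lemma star0 (R : rcfType) (A : starAlgType R) : star (0 : A) = 0.
Proof. by apply: (addrI (star (0 : A))); rewrite -starD !addr0. Qed.

Lemma starN (R : rcfType) (A : starAlgType R) (a : A) : star (- a) = - star a.
Proof. by apply: (addrI (star a)); rewrite -starD !subrr star0. Qed.

Lemma starB (R : rcfType) (A : starAlgType R) (a b : A) :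
  star (a - b) = star a - star b.
Proof. by rewrite starD starN. Qed.

Lemma star1 (R : rcfType) (A : starAlgType R) : star (1 : A) = 1.
Proof. by rewrite -[LHS]mulr1 -[X in _ * X]starK -starM mulr1 starK. Qed.

Fact add_cross (V : zmodType) (x p q y z w : V) :
  (x + p) + (q + y) - ((z + q) + (p + w)) = (x - z) + (y - w).
Proof.
have -> : (x + p) + (q + y) = (x + y) + (p + q).
  by rewrite [q + y]addrC addrACA.
have -> : (z + q) + (p + w) = (z + w) + (p + q).
  by rewrite [p + w]addrC [p + q]addrC addrACA.
by rewrite opprD [LHS]addrACA subrr addr0 opprD [LHS]addrACA.
Qed.

Lemma lie_gen_setP (R : rcfType) (A : starAlgType R) (S : (A -> A) -> Prop)
    (SP : forall d, S d -> derivation d /\ hermitian_der d) (d : A -> A) :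
  lie_gen_set S d -> derivation d /\ hermitian_der d.
Proof.
elim=> {d} [d /SP //||r d d' _ [[dl dm] dh] _ [[dl' dm'] dh']
                     |d d' _ [[dl dm] dh] _ [[dl' dm'] dh']].
- split; last by move=> a; rewrite star0.
  by split=> [c a b|a b]; rewrite ?(scaler0, mul0r, mulr0, addr0).
- split; last by move=> a; rewrite /der_lin starD starZ conjc_real dh dh'.
  split=> [c a b|a b]; rewrite /der_lin.
    rewrite dl dl' !scalerDr !scalerA [(_%:C)%C * c]mulrC.
    by rewrite !addrA; congr (_ + _); rewrite -!addrA; congr (_ + _); rewrite addrC.
  rewrite dm dm' scalerDr mulrDl mulrDr scalerAl scalerAr !addrA.
  by congr (_ + _); rewrite -!addrA; congr (_ + _); rewrite addrC.
- have dB x y : d (x + y) = d x + d y by have := dl 1 x y; rewrite !scale1r.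
  have dB' x y : d' (x + y) = d' x + d' y by have := dl' 1 x y; rewrite !scale1r.
  split; last first.
    move=> a; rewrite /der_bracket starB.
    by rewrite -[d' (star a)]starK dh dh' -[d (star a)]starK dh dh'.
  split=> [c a b|a b]; rewrite /der_bracket.
    rewrite !(dl, dl') scalerBr !opprD !addrA; congr (_ + _).
    by rewrite -!addrA; congr (_ + _); rewrite addrC.
  rewrite !(dm, dm') !(dB, dB') !(dm, dm') mulrBl mulrBr.
  exact: add_cross.
Qed.

Definition lie_gen (R : rcfType) (A : starAlgType R) (S : (A -> A) -> Prop)
    (SP : forall d, S d -> derivation d /\ hermitian_der d) : herm_lie A :=
  HermLie (lie_gen_setP SP) (LieZero S) (@LieLin _ _ S) (@LieBracket _ _ S).

(* The *-algebra presented by generators and relations: terms in Z, W over the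
   signature of unital *-algebras over C, modulo the least congruence containing
   the axioms of unital *-algebras and the relations of the 3-sphere.  A scalar
   c stands for the element c 1. *)
Inductive s3_term (R : realType) : Type :=
| TZ
| TW
| TC of R[i]
| TAdd of s3_term R & s3_term R
| TMul of s3_term R & s3_term R
| TStar of s3_term R.

Arguments TZ {R}.
Arguments TW {R}.

Definition s3_q (R : realType) (theta : R) : R[i] :=
  Complex (cos (2 * pi * theta)) (sin (2 * pi * theta)).

Inductive s3_rel (R : realType) (theta : R) : s3_term R -> s3_term R -> Prop :=
| RRefl t : s3_rel theta t t
| RSym t u : s3_rel theta t u -> s3_rel theta u t
| RTrans t u v : s3_rel theta t u -> s3_rel theta u v -> s3_rel theta t v
| RAdd t t' u u' : s3_rel theta t t' -> s3_rel theta u u' ->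
    s3_rel theta (TAdd t u) (TAdd t' u')
| RMul t t' u u' : s3_rel theta t t' -> s3_rel theta u u' ->
    s3_rel theta (TMul t u) (TMul t' u')
| RStar t t' : s3_rel theta t t' -> s3_rel theta (TStar t) (TStar t')
| RAddA t u v : s3_rel theta (TAdd t (TAdd u v)) (TAdd (TAdd t u) v)
| RAddC t u : s3_rel theta (TAdd t u) (TAdd u t)
| RAdd0 t : s3_rel theta (TAdd (TC 0) t) t
| RAddN t : s3_rel theta (TAdd (TMul (TC (-1)) t) t) (TC 0)
| RMulA t u v : s3_rel theta (TMul t (TMul u v)) (TMul (TMul t u) v)
| RMul1 t : s3_rel theta (TMul (TC 1) t) t
| RMulDl t u v : s3_rel theta (TMul (TAdd t u) v) (TAdd (TMul t v) (TMul u v))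
| RMulDr t u v : s3_rel theta (TMul t (TAdd u v)) (TAdd (TMul t u) (TMul t v))
| RCAdd c c' : s3_rel theta (TC (c + c')) (TAdd (TC c) (TC c'))
| RCMul c c' : s3_rel theta (TC (c * c')) (TMul (TC c) (TC c'))
| RCCentral c t : s3_rel theta (TMul (TC c) t) (TMul t (TC c))
| RStarK t : s3_rel theta (TStar (TStar t)) t
| RStarD t u : s3_rel theta (TStar (TAdd t u)) (TAdd (TStar t) (TStar u))
| RStarM t u : s3_rel theta (TStar (TMul t u)) (TMul (TStar u) (TStar t))
| RStarC c : s3_rel theta (TStar (TC c)) (TC (conjc c))
| RWZ : s3_rel theta (TMul TW TZ) (TMul (TC (s3_q theta)) (TMul TZ TW))
| RWsZ : s3_rel theta (TMul (TStar TW) TZ)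
           (TMul (TC (conjc (s3_q theta))) (TMul TZ (TStar TW)))
| RWZs : s3_rel theta (TMul TW (TStar TZ))
           (TMul (TC (conjc (s3_q theta))) (TMul (TStar TZ) TW))
| RWsZs : s3_rel theta (TMul (TStar TW) (TStar TZ))
            (TMul (TC (s3_q theta)) (TMul (TStar TZ) (TStar TW)))
| RZsZ : s3_rel theta (TMul (TStar TZ) TZ) (TMul TZ (TStar TZ))
| RWsW : s3_rel theta (TMul (TStar TW) TW) (TMul TW (TStar TW))
| RWWs : s3_rel theta (TMul TW (TStar TW))
           (TAdd (TC 1) (TMul (TC (-1)) (TMul TZ (TStar TZ)))).

HB.instance Definition _ (R : realType) := gen_eqMixin (s3_term R).
HB.instance Definition _ (R : realType) := gen_choiceMixin (s3_term R).

Definition s3_relb (R : realType) (theta : R) (t u : s3_term R) : bool :=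
  `[< s3_rel theta t u >].

Lemma s3_relb_refl (R : realType) (theta : R) : reflexive (s3_relb theta).
Proof. by move=> t; apply/asboolP; apply: RRefl. Qed.

Lemma s3_relb_sym (R : realType) (theta : R) : symmetric (s3_relb theta).
Proof. by move=> t u; apply/asboolP/asboolP; apply: RSym. Qed.

Lemma s3_relb_trans (R : realType) (theta : R) : transitive (s3_relb theta).
Proof. by move=> u t v /asboolP tu /asboolP uv; apply/asboolP; apply: RTrans uv. Qed.

Canonical s3_equiv (R : realType) (theta : R) : equiv_rel (s3_term R) :=
  EquivRel (s3_relb theta) (s3_relb_refl theta) (s3_relb_sym theta)
    (@s3_relb_trans R theta).

Definition S3 (R : realType) (theta : R) : Type := {eq_quot s3_equiv theta}.
HB.instance Definition _ (R : realType) (theta : R) :=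
  Choice.copy (S3 theta) {eq_quot s3_equiv theta}.

Definition s3_pi (R : realType) (theta : R) (t : s3_term R) : S3 theta :=
  \pi_({eq_quot s3_equiv theta}) t.

Definition s3_repr (R : realType) (theta : R) (x : S3 theta) : s3_term R :=
  repr (x : {eq_quot s3_equiv theta}).

Lemma s3_reprK (R : realType) (theta : R) : cancel (@s3_repr R theta) (@s3_pi R theta).
Proof. by move=> x; rewrite /s3_pi /s3_repr reprK. Qed.

Lemma s3_piP (R : realType) (theta : R) (t u : s3_term R) :
  s3_pi theta t = s3_pi theta u <-> s3_rel theta t u.
Proof.
rewrite /s3_pi; split=> [/eqquotP/asboolP //|tu].
by apply/eqquotP/asboolP.
Qed.

Lemma s3_repr_rel (R : realType) (theta : R) (t : s3_term R) :
  s3_rel theta (s3_repr (s3_pi theta t)) t.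
Proof. by apply/s3_piP; rewrite s3_reprK. Qed.

Definition s3_add (R : realType) (theta : R) (x y : S3 theta) : S3 theta :=
  s3_pi theta (TAdd (s3_repr x) (s3_repr y)).
Definition s3_mul (R : realType) (theta : R) (x y : S3 theta) : S3 theta :=
  s3_pi theta (TMul (s3_repr x) (s3_repr y)).
Definition s3_star (R : realType) (theta : R) (x : S3 theta) : S3 theta :=
  s3_pi theta (TStar (s3_repr x)).
Definition s3_const (R : realType) (theta : R) (c : R[i]) : S3 theta :=
  s3_pi theta (TC c).

Lemma s3_addE (R : realType) (theta : R) t u :
  s3_add (s3_pi theta t) (s3_pi theta u) = s3_pi theta (TAdd t u).
Proof. by apply/s3_piP; apply: RAdd; apply: s3_repr_rel. Qed.

Lemma s3_mulE (R : realType) (theta : R) t u :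
  s3_mul (s3_pi theta t) (s3_pi theta u) = s3_pi theta (TMul t u).
Proof. by apply/s3_piP; apply: RMul; apply: s3_repr_rel. Qed.

Lemma s3_starE (R : realType) (theta : R) t :
  s3_star (s3_pi theta t) = s3_pi theta (TStar t).
Proof. by apply/s3_piP; apply: RStar; apply: s3_repr_rel. Qed.

Lemma s3_ind (R : realType) (theta : R) (P : S3 theta -> Prop) :
  (forall t, P (s3_pi theta t)) -> forall x, P x.
Proof. by move=> PP x; rewrite -(s3_reprK x). Qed.

Section S3Algebra.
Context (R : realType) (theta : R).
Local Notation S := (S3 theta).
Local Notation add := (@s3_add R theta).
Local Notation mul := (@s3_mul R theta).
Local Notation const := (@s3_const R theta).

Lemma s3_addA : associative add.
Proof.
elim/s3_ind=> t; elim/s3_ind=> u; elim/s3_ind=> v; rewrite !s3_addE.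
by apply/s3_piP; apply: RAddA.
Qed.

Lemma s3_addC : commutative add.
Proof.
by elim/s3_ind=> t; elim/s3_ind=> u; rewrite !s3_addE; apply/s3_piP; apply: RAddC.
Qed.

Lemma s3_add0 : left_id (const 0) add.
Proof. by elim/s3_ind=> t; rewrite s3_addE; apply/s3_piP; apply: RAdd0. Qed.

Lemma s3_addN : left_inverse (const 0) (mul (const (-1))) add.
Proof.
by elim/s3_ind=> t; rewrite s3_mulE s3_addE; apply/s3_piP; apply: RAddN.
Qed.

Lemma s3_mulA : associative mul.
Proof.
elim/s3_ind=> t; elim/s3_ind=> u; elim/s3_ind=> v; rewrite !s3_mulE.
by apply/s3_piP; apply: RMulA.
Qed.

Lemma s3_mul1l : left_id (const 1) mul.
Proof. by elim/s3_ind=> t; rewrite s3_mulE; apply/s3_piP; apply: RMul1. Qed.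

Lemma s3_constC c x : mul (const c) x = mul x (const c).
Proof.
by elim/s3_ind: x => t; rewrite !s3_mulE; apply/s3_piP; apply: RCCentral.
Qed.

Lemma s3_mul1r : right_id (const 1) mul.
Proof. by move=> x; rewrite -s3_constC s3_mul1l. Qed.

Lemma s3_mulDl : left_distributive mul add.
Proof.
elim/s3_ind=> t; elim/s3_ind=> u; elim/s3_ind=> v; rewrite !(s3_mulE, s3_addE).
by apply/s3_piP; apply: RMulDl.
Qed.

Lemma s3_mulDr : right_distributive mul add.
Proof.
elim/s3_ind=> t; elim/s3_ind=> u; elim/s3_ind=> v; rewrite !(s3_mulE, s3_addE).
by apply/s3_piP; apply: RMulDr.
Qed.

(* The character Z |-> 1, W |-> 0, which shows that S3 is not trivial. *)
Fixpoint s3_char (t : s3_term R) : R[i] :=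
  match t with
  | TZ => 1
  | TW => 0
  | TC c => c
  | TAdd t u => s3_char t + s3_char u
  | TMul t u => s3_char t * s3_char u
  | TStar t => conjc (s3_char t)
  end.

Lemma s3_charP t u : s3_rel theta t u -> s3_char t = s3_char u.
Proof.
elim=> {t u} //=.
- by move=> t u v _ -> _ ->.
- by move=> t t' u u' _ -> _ ->.
- by move=> t t' u u' _ -> _ ->.
- by move=> t t' _ ->.
- by move=> *; rewrite addrA.
- by move=> *; rewrite addrC.
- by move=> *; rewrite add0r.
- by move=> *; rewrite mulN1r addNr.
- by move=> *; rewrite mulrA.
- by move=> *; rewrite mul1r.
- by move=> *; rewrite mulrDl.
- by move=> *; rewrite mulrDr.
- by move=> *; rewrite mulrC.
- by move=> *; rewrite conjcK.
- by move=> *; rewrite rmorphD.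
- by move=> *; rewrite rmorphM mulrC.
- by rewrite !(mul0r, mulr0).
- by rewrite oppr0 !(mul0r, mulr0).
- by rewrite !(mul0r, mulr0).
- by rewrite oppr0 !(mul0r, mulr0).
- by rewrite mulrC.
- by rewrite mulrC.
- by rewrite oppr0 mul0r mul1r mulN1r; apply/esym/subrr.
Qed.

Lemma s3_1neq0 : const 1 != const 0.
Proof. by apply/eqP => /s3_piP /s3_charP /= /eqP; rewrite oner_eq0. Qed.

HB.instance Definition _ :=
  GRing.isZmodule.Build S s3_addA s3_addC s3_add0 s3_addN.
HB.instance Definition _ :=
  GRing.Zmodule_isNzRing.Build S s3_mulA s3_mul1l s3_mul1r s3_mulDl s3_mulDr
    s3_1neq0.

Definition s3_scale (c : R[i]) (x : S) : S := mul (const c) x.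

Lemma s3_constM c c' : const (c * c') = mul (const c) (const c').
Proof. by rewrite s3_mulE; apply/s3_piP; apply: RCMul. Qed.

Lemma s3_constD c c' : const (c + c') = add (const c) (const c').
Proof. by rewrite s3_addE; apply/s3_piP; apply: RCAdd. Qed.

Lemma s3_scaleA c c' x : s3_scale c (s3_scale c' x) = s3_scale (c * c') x.
Proof. by rewrite /s3_scale s3_mulA s3_constM. Qed.

Lemma s3_scale1 : left_id 1 s3_scale.
Proof. exact: s3_mul1l. Qed.

Lemma s3_scaleDr : right_distributive s3_scale +%R.
Proof. by move=> c x y; rewrite /s3_scale [LHS]s3_mulDr. Qed.

Lemma s3_scaleDl x : {morph s3_scale^~ x : c c' / c + c'}.
Proof. by move=> c c'; rewrite /s3_scale s3_constD [LHS]s3_mulDl. Qed.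

HB.instance Definition _ :=
  GRing.Zmodule_isLmodule.Build R[i] S s3_scaleA s3_scale1 s3_scaleDr s3_scaleDl.

Lemma s3_scaleAl (c : R[i]) (x y : S) : c *: (x * y) = (c *: x) * y.
Proof. exact: s3_mulA. Qed.

HB.instance Definition _ := GRing.Lmodule_isLalgebra.Build R[i] S s3_scaleAl.

Lemma s3_scaleAr (c : R[i]) (x y : S) : c *: (x * y) = x * (c *: y).
Proof.
rewrite s3_scaleAl; transitivity ((x * const c) * y).
  by congr (_ * _); apply: s3_constC.
by rewrite -mulrA.
Qed.

HB.instance Definition _ := GRing.Lalgebra_isAlgebra.Build R[i] S s3_scaleAr.

Lemma s3_starK : involutive (@s3_star R theta).
Proof. by elim/s3_ind=> t; rewrite !s3_starE; apply/s3_piP; apply: RStarK. Qed.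

Lemma s3_starD : {morph @s3_star R theta : a b / a + b}.
Proof.
elim/s3_ind=> t; elim/s3_ind=> u.
rewrite [LHS](congr1 _ (s3_addE _ _ _)) [RHS](f_equal2 add (s3_starE _ _) (s3_starE _ _)).
by rewrite s3_starE s3_addE; apply/s3_piP; apply: RStarD.
Qed.

Lemma s3_starM (a b : S) : s3_star (a * b) = s3_star b * s3_star a.
Proof.
elim/s3_ind: a => t; elim/s3_ind: b => u.
rewrite [LHS](congr1 _ (s3_mulE _ _ _)) [RHS](f_equal2 mul (s3_starE _ _) (s3_starE _ _)).
by rewrite s3_starE s3_mulE; apply/s3_piP; apply: RStarM.
Qed.

Lemma s3_starC (c : R[i]) : s3_star (const c) = const (conjc c).
Proof. by rewrite s3_starE; apply/s3_piP; apply: RStarC. Qed.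

Lemma s3_starZ (c : R[i]) (a : S) : s3_star (c *: a) = conjc c *: s3_star a.
Proof.
transitivity (s3_star (const c * a)); first by [].
rewrite s3_starM s3_starC; exact/esym/s3_constC.
Qed.

HB.instance Definition _ :=
  isStarAlgebra.Build R S s3_starK s3_starD s3_starM s3_starZ.

Definition S3_Z : S := s3_pi theta TZ.
Definition S3_W : S := s3_pi theta TW.

Local Notation q := (s3_q theta).
Local Notation Z := S3_Z.
Local Notation W := S3_W.

Lemma s3_piD t u : s3_pi theta (TAdd t u) = s3_pi theta t + s3_pi theta u.
Proof. by rewrite -s3_addE. Qed.
Lemma s3_piM t u : s3_pi theta (TMul t u) = s3_pi theta t * s3_pi theta u.
Proof. by rewrite -s3_mulE. Qed.
Lemma s3_piS t : s3_pi theta (TStar t) = star (s3_pi theta t).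
Proof. by rewrite -s3_starE. Qed.
Lemma s3_piC c : s3_pi theta (TC c) = c%:A.
Proof. exact/esym/s3_mul1r. Qed.

Local Definition s3_piE := (s3_piD, s3_piM, s3_piS, s3_piC).

Lemma S3_WZ : W * Z = q *: (Z * W).
Proof. by have /s3_piP := RWZ theta; rewrite !s3_piE mulr_algl. Qed.
Lemma S3_WsZ : star W * Z = conjc q *: (Z * star W).
Proof. by have /s3_piP := RWsZ theta; rewrite !s3_piE mulr_algl. Qed.
Lemma S3_WZs : W * star Z = conjc q *: (star Z * W).
Proof. by have /s3_piP := RWZs theta; rewrite !s3_piE mulr_algl. Qed.
Lemma S3_WsZs : star W * star Z = q *: (star Z * star W).
Proof. by have /s3_piP := RWsZs theta; rewrite !s3_piE mulr_algl. Qed.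
Lemma S3_ZsZ : star Z * Z = Z * star Z.
Proof. by have /s3_piP := RZsZ theta; rewrite !s3_piE. Qed.
Lemma S3_WsW : star W * W = W * star W.
Proof. by have /s3_piP := RWsW theta; rewrite !s3_piE. Qed.
Lemma S3_WWs : W * star W = 1 - Z * star Z.
Proof.
by have /s3_piP := RWWs theta; rewrite !s3_piE mulr_algl scaleN1r scale1r.
Qed.


(* The derivation with prescribed values dz, dw on Z, W, computed on terms by
   the Leibniz rule and compatibility with the involution.  It is well defined
   on S3 only when (dz, dw) is compatible with the relations. *)
Fixpoint s3_term_der (dz dw : S) (t : s3_term R) : S :=
  match t with
  | TZ => dz
  | TW => dw
  | TC _ => 0
  | TAdd t u => s3_term_der dz dw t + s3_term_der dz dw u
  | TMul t u => s3_term_der dz dw t * s3_pi theta u +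
                s3_pi theta t * s3_term_der dz dw u
  | TStar t => star (s3_term_der dz dw t)
  end.

Definition S3_der (dz dw : S) (x : S) : S := s3_term_der dz dw (s3_repr x).

Definition central (a : S) : Prop := forall x : S, a * x = x * a.

Lemma central_star a : central a -> central (star a).
Proof. by move=> ca x; rewrite -[x]starK -!starM ca. Qed.

Section Der.
Context (al be : S) (cal : central al) (cbe : central be).
Hypothesis alpha_beta :
  W * star W * (be + star be) = - (Z * star Z * (al + star al)).
Local Notation der := (s3_term_der (Z * al) (W * be)).

Lemma s3_term_derP t u : s3_rel theta t u -> der t = der u.
Proof.
have cals := central_star cal; have cbes := central_star cbe.
have mvc c : central c -> forall x y, x * c * y = x * y * c.
  by move=> cc x y; rewrite -mulrA cc mulrA.
have mv := (mvc _ cal, mvc _ cbe, mvc _ cals, mvc _ cbes).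
suff H : s3_rel theta t u -> s3_pi theta t = s3_pi theta u /\ der t = der u.
  by case/H.
elim=> {t u} //=.
- by move=> t u _ [-> ->].
- by move=> t u v _ [-> ->] _ [-> ->].
- by move=> t t' u u' _ [e ->] _ [e' ->]; rewrite !s3_piE e e'.
- by move=> t t' u u' _ [e ->] _ [e' ->]; rewrite !s3_piE e e'.
- by move=> t t' _ [e ->]; rewrite !s3_piE e.
- by move=> *; rewrite !s3_piE !addrA.
- by move=> t u; rewrite !s3_piE; split; apply: addrC.
- by move=> t; rewrite !s3_piE scale0r !add0r.
- by move=> t; rewrite !s3_piE !mul0r add0r !mulr_algl !scaleN1r !addNr scale0r.
- by move=> t u v; rewrite !s3_piE !mulrDl !mulrDr !mulrA !addrA.
- by move=> t; rewrite !s3_piE !mulr_algl !scale1r mul0r add0r.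
- move=> t u v; rewrite !s3_piE !mulrDl; split=> //.
  by rewrite [RHS]addrACA.
- move=> t u v; rewrite !s3_piE !mulrDr; split=> //.
  by rewrite [RHS]addrACA.
- by move=> c c'; rewrite !s3_piE scalerDl addr0.
- by move=> c c'; rewrite !s3_piE mul0r mulr0 addr0 mulr_algl scalerA.
- by move=> c t; rewrite !s3_piE mul0r mulr0 addr0 add0r !mulr_algl !mulr_algr.
- by move=> t; rewrite !s3_piE !starK.
- by move=> t u; rewrite !s3_piE !starD.
- by move=> t u; rewrite !s3_piE !starD !starM addrC.
- by move=> c; rewrite !s3_piE starZ star1 star0.
- rewrite !s3_piE !mulr_algl mul0r add0r -/Z -/W S3_WZ; split=> //.
  by rewrite !mulrA !mv S3_WZ -!scalerAl -scalerDr addrC.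
- rewrite !s3_piE !mulr_algl mul0r add0r -/Z -/W S3_WsZ; split=> //.
  by rewrite !starM ?cals ?cbes !mulrA !mv S3_WsZ -!scalerAl -scalerDr addrC.
- rewrite !s3_piE !mulr_algl mul0r add0r -/Z -/W S3_WZs; split=> //.
  by rewrite !starM ?cals !mulrA !mv S3_WZs -!scalerAl -scalerDr addrC.
- rewrite !s3_piE !mulr_algl mul0r add0r -/Z -/W S3_WsZs; split=> //.
  by rewrite !starM ?cals ?cbes !mulrA !mv S3_WsZs -!scalerAl -scalerDr addrC.
- rewrite !s3_piE -/Z -/W S3_ZsZ; split=> //.
  by rewrite !starM ?cals !mulrA !mv S3_ZsZ addrC.
- rewrite !s3_piE -/Z -/W S3_WsW; split=> //.
  by rewrite !starM ?cbes !mulrA !mv S3_WsW addrC.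
- rewrite !s3_piE -/Z -/W !mulr_algl scale1r !scaleN1r -S3_WWs; split=> //.
  rewrite mul0r !add0r !starM ?cals ?cbes !mulrA !mv -!mulrDr; exact: alpha_beta.
Qed.

Lemma S3_derE t : S3_der (Z * al) (W * be) (s3_pi theta t) = der t.
Proof. by apply: s3_term_derP; apply: s3_repr_rel. Qed.

Lemma S3_derP :
  derivation (S3_der (Z * al) (W * be)) /\ hermitian_der (S3_der (Z * al) (W * be)).
Proof.
split; [split|].
- move=> c; elim/s3_ind=> t; elim/s3_ind=> u.
  rewrite -![c *: s3_pi theta t]mulr_algl -s3_piC -s3_piM -s3_piD !S3_derE /=.
  by rewrite s3_piC mul0r add0r mulr_algl.
- by elim/s3_ind=> t; elim/s3_ind=> u; rewrite -s3_piM !S3_derE.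
- by elim/s3_ind=> t; rewrite -s3_piS !S3_derE /= starK.
Qed.

Lemma S3_der_Z : S3_der (Z * al) (W * be) Z = Z * al.
Proof. by rewrite S3_derE. Qed.

Lemma S3_der_W : S3_der (Z * al) (W * be) W = W * be.
Proof. by rewrite S3_derE. Qed.

End Der.

Definition S3_Z2 : S := Z * star Z.
Definition S3_W2 : S := W * star W.

Lemma s3_qK : q * conjc q = 1.
Proof.
apply/eqP; rewrite eq_complex /=; apply/andP; split; apply/eqP.
  by rewrite mulrN opprK -!expr2 cos2Dsin2.
by rewrite mulrN mulrC addNr.
Qed.

Lemma central_Z2 : central S3_Z2.
Proof.
have qK := s3_qK; have qK' : conjc q * q = 1 by rewrite mulrC.
have hZ : star S3_Z2 = S3_Z2 by rewrite starM starK.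
elim/s3_ind; elim=> [||c|t IHt u IHu|t IHt u IHu|t IHt].
- by rewrite /S3_Z2 -/Z -mulrA S3_ZsZ.
- rewrite -/W /S3_Z2 [RHS]mulrA S3_WZ -scalerAl -[Z * W * _]mulrA S3_WZs.
  by rewrite -scalerAr scalerA qK scale1r mulrA.
- by rewrite s3_piC mulr_algl mulr_algr.
- by rewrite s3_piD mulrDl mulrDr IHt IHu.
- by rewrite s3_piM mulrA IHt -mulrA IHu mulrA.
- by rewrite s3_piS -{1}hZ -starM -IHt starM hZ.
Qed.

Lemma central_W2 : central S3_W2.
Proof.
by move=> x; rewrite /S3_W2 S3_WWs mulrBl mulrBr mul1r mulr1 central_Z2.
Qed.

Lemma S3_Z2_herm : star S3_Z2 = S3_Z2. Proof. by rewrite starM starK. Qed.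
Lemma S3_W2_herm : star S3_W2 = S3_W2. Proof. by rewrite starM starK. Qed.

Definition S3_partial1 : S -> S := S3_der ('i%C *: Z) 0.
Definition S3_partial2 : S -> S := S3_der 0 ('i%C *: W).
Definition S3_partial3 : S -> S := S3_der (Z * S3_W2) (- (W * S3_Z2)).

Lemma central_alg (c : R[i]) : central c%:A.
Proof. by move=> x; rewrite mulr_algl mulr_algr. Qed.

Lemma central0 : central 0.
Proof. by move=> x; rewrite mul0r mulr0. Qed.

Lemma star_i : star (('i%C : R[i])%:A : S) = - ('i%C : R[i])%:A.
Proof.
rewrite starZ star1 -scaleNr; congr (_ *: _).
by apply/eqP; rewrite eq_complex /= oppr0 !eqxx.
Qed.

Lemma S3_partial1E : S3_partial1 = S3_der (Z * ('i%C : R[i])%:A) (W * 0).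
Proof. by rewrite /S3_partial1 mulr_algr mulr0. Qed.

Lemma S3_partial2E : S3_partial2 = S3_der (Z * 0) (W * ('i%C : R[i])%:A).
Proof. by rewrite /S3_partial2 mulr_algr mulr0. Qed.

Lemma S3_partial3E : S3_partial3 = S3_der (Z * S3_W2) (W * - S3_Z2).
Proof. by rewrite /S3_partial3 mulrN. Qed.

Fact S3_compat1 : W * star W * (0 + star 0) =
  - (Z * star Z * (('i%C : R[i])%:A + star ('i%C : R[i])%:A)).
Proof. by rewrite star_i star0 addr0 subrr !mulr0 oppr0. Qed.

Fact S3_compat2 : W * star W * (('i%C : R[i])%:A + star ('i%C : R[i])%:A) =
  - (Z * star Z * (0 + star 0)).
Proof. by rewrite star_i star0 addr0 subrr !mulr0 oppr0. Qed.

Fact S3_compat3 : W * star W * (- S3_Z2 + star (- S3_Z2)) =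
  - (Z * star Z * (S3_W2 + star S3_W2)).
Proof.
rewrite starN S3_Z2_herm S3_W2_herm -opprD mulrN -/S3_W2 -/S3_Z2; congr (- _).
by rewrite !mulrDr central_W2.
Qed.

Fact central_NZ2 : central (- S3_Z2).
Proof. by move=> x; rewrite mulNr mulrN central_Z2. Qed.

Let der1P := S3_derP (@central_alg 'i%C) central0 S3_compat1.
Let der2P := S3_derP central0 (@central_alg 'i%C) S3_compat2.
Let der3P := S3_derP central_W2 central_NZ2 S3_compat3.

Lemma S3_partial1P :
  [/\ derivation S3_partial1, hermitian_der S3_partial1,
      S3_partial1 Z = 'i%C *: Z & S3_partial1 W = 0].
Proof.
rewrite S3_partial1E; case: der1P => ? ?; split=> //.
  by rewrite (S3_der_Z (@central_alg 'i%C) central0 S3_compat1) mulr_algr.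
by rewrite (S3_der_W (@central_alg 'i%C) central0 S3_compat1) mulr0.
Qed.

Lemma S3_partial2P :
  [/\ derivation S3_partial2, hermitian_der S3_partial2,
      S3_partial2 Z = 0 & S3_partial2 W = 'i%C *: W].
Proof.
rewrite S3_partial2E; case: der2P => ? ?; split=> //.
  by rewrite (S3_der_Z central0 (@central_alg 'i%C) S3_compat2) mulr0.
by rewrite (S3_der_W central0 (@central_alg 'i%C) S3_compat2) mulr_algr.
Qed.

Lemma S3_partial3P :
  [/\ derivation S3_partial3, hermitian_der S3_partial3,
      S3_partial3 Z = Z * S3_W2 & S3_partial3 W = - (W * S3_Z2)].
Proof.
rewrite S3_partial3E; case: der3P => ? ?; split=> //.
  by rewrite (S3_der_Z central_W2 central_NZ2 S3_compat3).
by rewrite (S3_der_W central_W2 central_NZ2 S3_compat3) mulrN.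
Qed.

Definition S3_partials (d : S -> S) : Prop :=
  [\/ d = S3_partial1, d = S3_partial2 | d = S3_partial3].

Lemma S3_partialsP d : S3_partials d -> derivation d /\ hermitian_der d.
Proof.
case=> ->.
- by case: S3_partial1P.
- by case: S3_partial2P.
- by case: S3_partial3P.
Qed.

Definition S3_g : herm_lie S := lie_gen S3_partialsP.

Definition S3_d1 : lie_elt S3_g :=
  exist S3_g S3_partial1 (@LieGen _ _ S3_partials _ (Or31 _ _ erefl)).
Definition S3_d2 : lie_elt S3_g :=
  exist S3_g S3_partial2 (@LieGen _ _ S3_partials _ (Or32 _ _ erefl)).
Definition S3_d3 : lie_elt S3_g :=
  exist S3_g S3_partial3 (@LieGen _ _ S3_partials _ (Or33 _ _ erefl)).

Definition S3_X1 : S := (2 : R[i])^-1 *: (Z + star Z).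
Definition S3_X2 : S := (2 * 'i%C : R[i])^-1 *: (Z - star Z).
Definition S3_X3 : S := (2 : R[i])^-1 *: (W + star W).
Definition S3_X4 : S := (2 * 'i%C : R[i])^-1 *: (W - star W).

(* Row vectors with entries in the converse ring form the free right module. *)
Definition S3_row4 (a b c d : S) : 'rV[S^c]_4 :=
  \row_(j < 4) ([:: a; b; c; d] : seq S)`_j.

Definition S3_vec (a : 'I_3) : 'rV[S^c]_4 :=
  [:: S3_row4 (- S3_X2) S3_X1 0 0;
      S3_row4 0 0 (- S3_X4) S3_X3;
      S3_row4 (S3_X1 * S3_W2) (S3_X2 * S3_W2)
              (- (S3_X3 * S3_Z2)) (- (S3_X4 * S3_Z2))]`_a.

Definition S3_span : {pred 'rV[S^c]_4} :=
  fun v => `[< exists u : 'I_3 -> S, v = \sum_(a < 3) S3_vec a *r u a >].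

Fact S3_span_submod : submod_closed S3_span.
Proof.
split.
  apply/asboolP; exists (fun=> 0); rewrite big1 // => a _; exact: scale0r.
move=> c v w /asboolP [u ->] /asboolP [u' ->]; apply/asboolP.
exists (fun a => u a * c + u' a); rewrite scaler_sumr -big_split /=.
by apply: eq_bigr => a _; rewrite /ract scalerA -scalerDl.
Qed.

HB.instance Definition _ :=
  GRing.isSubmodClosed.Build S^c 'rV[S^c]_4 S3_span S3_span_submod.

Record S3_M : Type := S3MElt { S3_M_val : 'rV[S^c]_4; _ : S3_M_val \in S3_span }.
HB.instance Definition _ := [isSub for S3_M_val].
HB.instance Definition _ := [Choice of S3_M by <:].
HB.instance Definition _ := [SubChoice_isSubLmodule of S3_M by <:].

Fact S3_vec_in (a : 'I_3) : S3_vec a \in S3_span.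
Proof.
apply/asboolP; exists (fun b => (a == b)%:R).
rewrite (bigD1 a) //= eqxx big1 ?addr0 => [|b /negPf ba].
  exact/esym/scale1r.
by rewrite eq_sym ba; apply: scale0r.
Qed.

Definition S3_E (a : 'I_3) : S3_M := S3MElt (S3_vec_in a).
Definition S3_E1 : S3_M := S3_E (inord 0).
Definition S3_E2 : S3_M := S3_E (inord 1).
Definition S3_E3 : S3_M := S3_E (inord 2).

(* The coordinates of U in the basis (S3_E a): they exist by definition of
   S3_M, and are unique because S3_M is free on the S3_E a. *)
Definition S3_coord (U : S3_M) : {ffun 'I_3 -> S} :=
  xget 0 [set u : {ffun 'I_3 -> S} | U = \sum_(a < 3) S3_E a *r u a]%classic.

Definition S3_hmat (a b : 'I_3) : S :=
  if a == b then [:: S3_Z2; S3_W2; S3_Z2 * S3_W2]`_a else 0.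

Definition S3_h (U V : S3_M) : S :=
  \sum_(a < 3) \sum_(b < 3) star (S3_coord U a) * S3_hmat a b * S3_coord V b.

Definition S3_partial (a : 'I_3) : S -> S :=
  nth (fun=> 0) [:: S3_partial1; S3_partial2; S3_partial3] a.

(* The real coordinates of d in the basis of the three derivations; they exist
   because the derivations commute, so that S3_g is their real linear span, and
   are unique because the derivations are linearly independent over R. *)
Definition S3_gcoord (d : lie_elt S3_g) : {ffun 'I_3 -> R} :=
  xget 0 [set r : {ffun 'I_3 -> R} |
    forall x : S, proj1_sig d x = \sum_(a < 3) ((r a)%:C)%C *: S3_partial a x]%classic.

Definition S3_phi (d : lie_elt S3_g) : S3_M :=
  \sum_(a < 3) rscale (S3_gcoord d a) (S3_E a).

End S3Algebra.

(* Main.v *)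
Require Import Defs.
From mathcomp Require Import all_boot all_order all_algebra.
From mathcomp Require Import all_classical all_reals all_analysis.
From mathcomp Require Import complex.
From mathcomp Require Import ring.
Import GRing.Theory Num.Theory.
Local Open Scope ring_scope.

(** Uniqueness is the Koszul argument.  If two connections satisfy the axioms,
    their difference T(d,e,f) = h(D_d phi(e), phi(f)) is symmetric in (d,e)
    because both are torsion free, and antisymmetric in (e,f) because both are
    metric and h(phi(e), phi(f)), h(nabla_d phi(e), phi(f)) are hermitian.  Such
    a T vanishes; since phi(g) generates the module and h is non-degenerate, the
    connections agree ([pseudo_riemannian_unique]).

    For existence, the formulas of the statement are read as a table of
    Christoffel symbols [S3_christoffel].  All of them, like the entries of the
    metric, lie in the set of central hermitian elements, which is closed under
    sums, products, real scalars and the derivations in g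
    ([central_herm_der]).  Hence every element of the form
    h(nabla_{d_1} nabla_{d_2} phi(e), phi(e')) is hermitian, torsion freeness is
    the symmetry of the symbols in their two lower indices, and compatibility
    with the metric is the finite family of identities
    [S3_christoffel_metric].

    These arguments presuppose that the objects are not degenerate: that
    E_1, E_2, E_3 are linearly independent, that h is non-degenerate, and that
    the three derivations are linearly independent over the reals.  Each of
    these reduces to the fact that neither |Z|^2 nor |W|^2 is a zero divisor
    ([S3_Z2_regular], [S3_W2_regular]).  Since the algebra is given by
    generators and relations, this needs a normal form.  With B = C[z, zbar],
    every element is a finite sum of b_n W^n and c_n (W^* )^(n+1) with b_n, c_n
    in B evaluated at Z and Z^*; so the algebra should look like the B-module V of
    pairs of polynomials over B.  Writing down the right multiplications by Z,
    Z^*, W, W^* on such pairs gives B-linear operators that satisfy the defining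
    relations ([s3_act_rel]), hence a right action on V.  The map x |-> (1,0).x
    is then injective, because evaluation of the normal form is a left inverse
    ([S3_coefK]).  It turns multiplication by |Z|^2 and |W|^2 into
    multiplication by the scalars z zbar and 1 - z zbar of the integral domain
    B, which is injective. *)

Set Implicit Arguments.
Unset Strict Implicit.
Unset Printing Implicit Defensive.

(** * Sums, polynomials and indices *)

Lemma morph_sum (U V : zmodType) (f : U -> V) (n : nat) (u : 'I_n -> U) :
  {morph f : x y / x + y} -> f (\sum_(k < n) u k) = \sum_(k < n) f (u k).
Proof.
move=> fD; apply: (big_morph f fD).
by apply: (addrI (f 0)); rewrite -fD !addr0.
Qed.

Lemma ord3_ind (P : 'I_3 -> Prop) :
  P (inord 0) -> P (inord 1) -> P (inord 2) -> forall a, P a.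
Proof.
by move=> P0 P1 P2 [[|[|[|//]]] lt_a]; rewrite -[Ordinal lt_a]inord_val.
Qed.

Lemma sum3 (V : zmodType) (F : 'I_3 -> V) :
  \sum_(a < 3) F a = F (inord 0) + F (inord 1) + F (inord 2).
Proof.
rewrite !big_ord_recl big_ord0 addr0 addrA; congr (F _ + F _ + F _);
  by apply/val_inj; rewrite /= inordK.
Qed.

Lemma conjcN1 (R : rcfType) : conjc (-1 : R[i]) = -1.
Proof. by rewrite rmorphN rmorph1. Qed.

Lemma poly_drop1 (A : nzRingType) (p : {poly A}) :
  p = drop_poly 1 p * 'X + (p`_0)%:P.
Proof.
apply/polyP => -[|i]; rewrite coefD coefMX coefC /= ?add0r //.
by rewrite coef_drop_poly addn1 addr0.
Qed.

Lemma coef_comp_scaleX (A : comNzRingType) (a : A) (p : {poly A}) (i : nat) :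
  (p \Po (a *: 'X))`_i = p`_i * a ^+ i.
Proof.
elim/poly_ind: p i => [|p c IHp] i; first by rewrite comp_poly0 coef0 mul0r.
rewrite comp_poly_MXaddC -scalerAr !coefD coefZ !coefMX !coefC.
case: i => [|i]; first by rewrite /= mulr0 !add0r expr0 mulr1.
by rewrite /= !addr0 IHp exprS mulrCA.
Qed.

Lemma one_sub_MX_neq0 (A : nzRingType) (p : {poly A}) : 1 - p * 'X != 0.
Proof.
apply/eqP => /(congr1 (fun r : {poly A} => r`_0)) /eqP.
by rewrite coefB coef1 coefMX coef0 /= subr0 oner_eq0.
Qed.

(** * Twisted shift operators on pairs of polynomials *)

Section ShiftOperators.
Variable A : comNzRingType.
Local Notation V := ({poly A} * {poly A})%type.

(** A pair (p, p') stands for the formal sum of p_n w^n and p'_n w'^(n+1), where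
    w w' = w' w = k.  [op_up] and [op_down] are then right multiplication by w
    and w'.  [op_twist] is right multiplication by an element that moves past w
    at the cost of the scalar r, past w' at the cost of s, and becomes the
    coefficient b; the extra factor s in the second component accounts for the
    index shift in w'^(n+1). *)
Definition op_twist (b r s : A) (v : V) : V :=
  (b *: (v.1 \Po (r *: 'X)), (s * b) *: (v.2 \Po (s *: 'X))).
Definition op_up (k : A) (v : V) : V :=
  (v.1 * 'X + (k * v.2`_0)%:P, k *: drop_poly 1 v.2).
Definition op_down (k : A) (v : V) : V :=
  (k *: drop_poly 1 v.1, v.2 * 'X + (v.1`_0)%:P).

Lemma pair_eq_coef (v w : V) :
  (forall i, v.1`_i = w.1`_i /\ v.2`_i = w.2`_i) -> v = w.
Proof.
case: v w => [p1 p2] [r1 r2] /= E; congr pair; apply/polyP => i.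
  by case: (E i).
by case: (E i).
Qed.

Let coefs := (coefD, coefZ, coefMX, coefC, coef_drop_poly, coef_comp_scaleX).

Lemma op_twist_linear b r s (c : A) v w :
  op_twist b r s (c *: v + w) = c *: op_twist b r s v + op_twist b r s w.
Proof. by apply: pair_eq_coef => i; rewrite /= !coefs; split; ring. Qed.

Lemma op_up_linear k (c : A) v w :
  op_up k (c *: v + w) = c *: op_up k v + op_up k w.
Proof. by apply: pair_eq_coef => -[|i]; rewrite /= !coefs /=; split; ring. Qed.

Lemma op_down_linear k (c : A) v w :
  op_down k (c *: v + w) = c *: op_down k v + op_down k w.
Proof. by apply: pair_eq_coef => -[|i]; rewrite /= !coefs /=; split; ring. Qed.

Lemma op_zero (f : V -> V) :
  (forall (c : A) v w, f (c *: v + w) = c *: f v + f w) -> f 0 = 0.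
Proof.
move=> fl; have := fl (-1) 0 0; rewrite scaleN1r addNr => ->.
by rewrite scaleN1r addNr.
Qed.
Lemma op_scale (f : V -> V) :
  (forall (c : A) v w, f (c *: v + w) = c *: f v + f w) ->
  forall c v, f (c *: v) = c *: f v.
Proof. by move=> fl c v; rewrite -[c *: v]addr0 fl (op_zero fl) addr0. Qed.

Definition op_twist_scale b r s := op_scale (op_twist_linear b r s).
Definition op_up_scale k := op_scale (op_up_linear k).
Definition op_down_scale k := op_scale (op_down_linear k).

Lemma op_twist_up b r s k v : r * s = 1 ->
  op_twist b r s (op_up k v) = r *: op_up k (op_twist b r s v).
Proof.
move=> rs; apply: pair_eq_coef => -[|i]; rewrite /= !coefs /= ?add0n ?addn1; split.
- by ring: rs.
- by rewrite exprS; ring: rs.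
- by rewrite exprS; ring.
- by rewrite !exprS; ring: rs.
Qed.

Lemma op_twist_down b r s k v : r * s = 1 ->
  op_twist b r s (op_down k v) = s *: op_down k (op_twist b r s v).
Proof.
move=> rs; apply: pair_eq_coef => -[|i]; rewrite /= !coefs /= ?add0n ?addn1; split.
- by rewrite exprS; ring: rs.
- by ring: rs.
- by rewrite !exprS; ring: rs.
- by rewrite exprS; ring.
Qed.

Lemma op_twistK b b' r s v : r * s = 1 ->
  op_twist b r s (op_twist b' s r v) = (b * b') *: v.
Proof.
move=> rs; have rsX i : r ^+ i * s ^+ i = 1 by rewrite -exprMn rs expr1n.
by apply: pair_eq_coef => i; rewrite /= !coefs; split; ring: rs (rsX i).
Qed.

Lemma op_upK k v : op_down k (op_up k v) = k *: v.
Proof.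
by apply: pair_eq_coef => -[|i]; rewrite /= !coefs /= ?add0n ?addn1; split; ring.
Qed.
Lemma op_downK k v : op_up k (op_down k v) = k *: v.
Proof.
by apply: pair_eq_coef => -[|i]; rewrite /= !coefs /= ?add0n ?addn1; split; ring.
Qed.

End ShiftOperators.

(** * A normal form; the squared moduli are not zero divisors *)

Section Regular.
Variables (R : realType) (theta : R).
Local Notation S := (S3 theta).
Local Notation Z := (S3_Z theta).
Local Notation W := (S3_W theta).
Local Notation q := (s3_q theta).
Local Notation B := {poly {poly R[i]}}.
Local Notation V := ({poly B} * {poly B})%type.

Definition bconst (c : R[i]) : B := c%:P%:P.
Definition bZ : B := 'X%:P.
Definition bZs : B := 'X.
Definition bW2 : B := 1 - bZ * bZs.

Local Arguments conjc : simpl never.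
Local Arguments s3_q : simpl never.

(** The right action of the algebra on V.  The involution has no counterpart on
    V, so the flag [s] asks for the action of the adjoint of the term: a star
    flips it, and it reverses products. *)
Fixpoint s3_act (s : bool) (t : s3_term R) (v : V) : V :=
  match t with
  | TZ => if s then op_twist bZs (bconst (conjc q)) (bconst q) v
          else op_twist bZ (bconst q) (bconst (conjc q)) v
  | TW => if s then op_down bW2 v else op_up bW2 v
  | TC c => bconst (if s then conjc c else c) *: v
  | TAdd t u => s3_act s t v + s3_act s u v
  | TMul t u =>
      if s then s3_act s t (s3_act s u v) else s3_act s u (s3_act s t v)
  | TStar t => s3_act (~~ s) t v
  end.

Lemma bconstD c d : bconst (c + d) = bconst c + bconst d.
Proof. by rewrite /bconst !polyCD. Qed.
Lemma bconstM c d : bconst (c * d) = bconst c * bconst d.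
Proof. by rewrite /bconst !polyCM. Qed.
Lemma bconst0 : bconst 0 = 0.
Proof. by rewrite /bconst !polyC0. Qed.
Lemma bconst1 : bconst 1 = 1.
Proof. by []. Qed.
Lemma bconstN1 : bconst (-1) = -1.
Proof. by rewrite /bconst !polyCN. Qed.
Lemma bconst_qK : bconst q * bconst (conjc q) = 1.
Proof. by rewrite -bconstM s3_qK. Qed.
Lemma bconst_qK' : bconst (conjc q) * bconst q = 1.
Proof. by rewrite mulrC bconst_qK. Qed.

(** Left multiplication by B commutes with right multiplication by the algebra. *)
Lemma s3_act_linear s t (b : B) (v w : V) :
  s3_act s t (b *: v + w) = b *: s3_act s t v + s3_act s t w.
Proof.
elim: t s v w => [||c|t IHt u IHu|t IHt u IHu|t IHt] s v w; cbn [s3_act].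
- by case: s; rewrite op_twist_linear.
- by case: s; rewrite ?op_up_linear ?op_down_linear.
- by rewrite scalerDr !scalerA mulrC.
- by rewrite IHt IHu scalerDr addrACA.
- by case: s; rewrite ?IHt ?IHu ?IHt.
- exact: IHt.
Qed.

Lemma s3_actD s t v w : s3_act s t (v + w) = s3_act s t v + s3_act s t w.
Proof. by have := s3_act_linear s t 1 v w; rewrite !scale1r. Qed.
Lemma s3_act_zero s t : s3_act s t 0 = 0.
Proof. by apply: (addrI (s3_act s t 0)); rewrite -s3_actD !addr0. Qed.
Lemma s3_act_scale s t b v : s3_act s t (b *: v) = b *: s3_act s t v.
Proof. by rewrite -[b *: v]addr0 s3_act_linear s3_act_zero addr0. Qed.

(** The operators satisfy the defining relations: the q-commutation relations
    are [op_twist_up] and [op_twist_down], and W W^* = 1 - Z Z^* holds because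
    [op_up] and [op_down] are mutually inverse up to 1 - z zbar. *)
Lemma s3_act_rel t u : s3_rel theta t u -> forall s v, s3_act s t v = s3_act s u v.
Proof.
have qK := bconst_qK; have qK' := bconst_qK'.
elim=> {t u}; cbn [s3_act negb] => //.
- by move=> t u v _ tu _ uv s w; rewrite tu uv.
- by move=> t t' u u' _ tt' _ uu' s v; rewrite tt' uu'.
- by move=> t t' u u' _ tt' _ uu' [] v; rewrite tt' uu'.
- by move=> t u v s w; rewrite addrA.
- by move=> t u s v; rewrite addrC.
- by move=> t s v; rewrite conjc0 if_same bconst0 scale0r add0r.
- move=> t s v; rewrite conjcN1 conjc0 !if_same s3_act_scale if_same.
  by rewrite bconstN1 bconst0 scaleN1r addNr scale0r.
- by move=> t u v [].
- by move=> t [] v; rewrite ?conjc1 bconst1 !scale1r.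
- by move=> t u v [] w; rewrite ?s3_actD.
- by move=> t u v [] w; rewrite ?s3_actD.
- by move=> c c' s v; case: s; rewrite ?rmorphD bconstD scalerDl.
- by move=> c c' [] v; rewrite ?rmorphM bconstM scalerA // mulrC.
- by move=> c t [] v; rewrite s3_act_scale.
- by move=> t s v; rewrite negbK.
- by move=> t u [] v.
- by move=> c [] v //=; rewrite conjcK.
- move=> [] v; rewrite /= ?(op_twist_scale, op_up_scale, op_down_scale)
    ?(op_twist_up, op_twist_down) //.
  by rewrite scalerA qK' scale1r.
- move=> [] v; rewrite /= ?conjcK ?(op_twist_scale, op_up_scale, op_down_scale)
    ?(op_twist_up, op_twist_down) //.
  by rewrite scalerA qK scale1r.
- move=> [] v; rewrite /= ?conjcK ?(op_twist_scale, op_up_scale, op_down_scale)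
    ?(op_twist_up, op_twist_down) //.
  by rewrite scalerA qK scale1r.
- move=> [] v; rewrite /= ?(op_twist_scale, op_up_scale, op_down_scale)
    ?(op_twist_up, op_twist_down) //.
  by rewrite scalerA qK' scale1r.
- by move=> [] v /=; rewrite !op_twistK // mulrC.
- by move=> [] v /=; rewrite op_upK op_downK.
- have eW (v : V) : bW2 *: v = v - (bZ * bZs) *: v.
    by rewrite /bW2 scalerBl scale1r.
  move=> [] v; rewrite /= ?conjcN1 ?conjc1 ?bconstN1 ?bconst1 ?scale1r
    ?op_twist_scale ?scaleN1r;
  by rewrite op_upK op_twistK // ?[bZs * bZ]mulrC eW.
Qed.

Fact S3_Zs_commr :
  commr_rmorph (@horner_alg R[i] S Z) (star Z).
Proof.
move=> p; elim/poly_ind: p => [|p c IHp]; first by rewrite rmorph0; apply: commr0.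
rewrite rmorphD rmorphM /= horner_algX horner_algC /GRing.comm.
rewrite mulrDl mulrDr mulr_algl mulr_algr mulrA IHp -!mulrA.
by rewrite S3_ZsZ.
Qed.

Definition S3_base : {rmorphism B -> S} := horner_morph S3_Zs_commr.

Lemma S3_base_Z : S3_base bZ = Z.
Proof. by rewrite /S3_base /bZ /= horner_morphC /= horner_algX. Qed.
Lemma S3_base_Zs : S3_base bZs = star Z.
Proof. by rewrite /S3_base /bZs /= horner_morphX. Qed.
Lemma S3_base_const c : S3_base (bconst c) = c%:A.
Proof. by rewrite /S3_base /bconst /= horner_morphC /= horner_algC. Qed.
Lemma S3_base_W2 : S3_base bW2 = W * star W.
Proof. by rewrite rmorphB rmorph1 rmorphM S3_base_Z S3_base_Zs S3_WWs. Qed.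

(** Horner evaluation keeps coefficients on the left, which is why the normal
    form has them there and why the action on V is a right action. *)
Definition S3_eval (x : S) (p : {poly B}) : S := (map_poly S3_base p).[x].

Lemma S3_evalD x p r : S3_eval x (p + r) = S3_eval x p + S3_eval x r.
Proof. by rewrite /S3_eval rmorphD hornerD. Qed.
Lemma S3_evalZ x b p : S3_eval x (b *: p) = S3_base b * S3_eval x p.
Proof. by rewrite /S3_eval map_polyZ hornerZ. Qed.
Lemma S3_evalC x b : S3_eval x b%:P = S3_base b.
Proof. by rewrite /S3_eval map_polyC hornerC. Qed.
Lemma S3_evalMX x p : S3_eval x (p * 'X) = S3_eval x p * x.
Proof. by rewrite /S3_eval rmorphM /= map_polyX hornerMX. Qed.
Lemma S3_eval0 x : S3_eval x 0 = 0.
Proof. by rewrite /S3_eval rmorph0 horner0. Qed.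

(** Moving b from the right of b_n x^n to its left multiplies it by c^n. *)
Lemma S3_eval_twist x (b c : B) p :
  (forall y : S, S3_base c * y = y * S3_base c) ->
  x * S3_base b = S3_base (c * b) * x ->
  S3_eval x (b *: (p \Po (c *: 'X))) = S3_eval x p * S3_base b.
Proof.
move=> cc xb; elim/poly_ind: p => [|p d IHp].
  by rewrite comp_poly0 scaler0 S3_eval0 mul0r.
have -> : b *: ((p * 'X + d%:P) \Po (c *: 'X)) =
    c *: ((b *: (p \Po (c *: 'X))) * 'X) + (b * d)%:P.
  rewrite comp_poly_MXaddC -scalerAr scalerDr !scalerA -scalerAl scalerA.
  by rewrite [c * b]mulrC -[b *: d%:P]mul_polyC -polyCM.
rewrite !S3_evalD S3_evalZ !S3_evalMX IHp !S3_evalC mulrDl.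
congr (_ + _); last by rewrite -!rmorphM mulrC.
by rewrite -[RHS]mulrA xb rmorphM !mulrA cc.
Qed.

Definition S3_of (v : V) : S := S3_eval W v.1 + S3_eval (star W) v.2 * star W.

Lemma S3_ofD v w : S3_of (v + w) = S3_of v + S3_of w.
Proof. by rewrite /S3_of /= !S3_evalD mulrDl addrACA. Qed.
Lemma S3_ofZ b v : S3_of (b *: v) = S3_base b * S3_of v.
Proof. by rewrite /S3_of /= !S3_evalZ mulrDr mulrA. Qed.

Lemma S3_base_W2c y : S3_base bW2 * y = y * S3_base bW2.
Proof. by rewrite S3_base_W2 central_W2. Qed.
Lemma S3_base_constc c y : S3_base (bconst c) * y = y * S3_base (bconst c).
Proof. by rewrite S3_base_const central_alg. Qed.

Lemma S3_of_mulW v : S3_of (op_up bW2 v) = S3_of v * W.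
Proof.
rewrite /S3_of /=.
have -> : S3_eval (star W) v.2 = S3_eval (star W) (drop_poly 1 v.2) * star W +
    S3_base v.2`_0.
  by rewrite [in LHS](poly_drop1 v.2) S3_evalD S3_evalMX S3_evalC.
rewrite S3_evalD S3_evalMX S3_evalC S3_evalZ rmorphM.
set e := S3_eval _ (drop_poly _ _); set f := S3_base _`_0.
rewrite mulrDl -[_ * star W * W]mulrA S3_WsW -S3_base_W2 -[in RHS]S3_base_W2c.
by rewrite mulrDr !mulrA -addrA; congr (_ + _); apply: addrC.
Qed.

Lemma S3_of_mulWs v : S3_of (op_down bW2 v) = S3_of v * star W.
Proof.
rewrite /S3_of /=.
have -> : S3_eval W v.1 = S3_eval W (drop_poly 1 v.1) * W + S3_base v.1`_0.
  by rewrite [in LHS](poly_drop1 v.1) S3_evalD S3_evalMX S3_evalC.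
rewrite S3_evalD S3_evalMX S3_evalC S3_evalZ.
set e := S3_eval _ (drop_poly _ _); set f := S3_base _`_0.
rewrite !mulrDl -[e * W * _]mulrA -S3_base_W2 -S3_base_W2c -addrA; congr (_ + _).
exact: addrC.
Qed.

Lemma S3_of_mulZ v :
  S3_of (op_twist bZ (bconst q) (bconst (conjc q)) v) = S3_of v * Z.
Proof.
have [cq cq'] := (S3_base_constc q, S3_base_constc (conjc q)).
rewrite /S3_of /= (S3_eval_twist _ cq); last first.
  by rewrite rmorphM S3_base_const S3_base_Z mulr_algl S3_WZ -scalerAl.
rewrite -scalerA S3_evalZ (S3_eval_twist _ cq'); last first.
  by rewrite rmorphM S3_base_const S3_base_Z mulr_algl S3_WsZ -scalerAl.
rewrite S3_base_Z mulrDl -!mulrA S3_WsZ; congr (_ + _).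
by rewrite S3_base_const mulr_algl -!scalerAr.
Qed.

Lemma S3_of_mulZs v :
  S3_of (op_twist bZs (bconst (conjc q)) (bconst q) v) = S3_of v * star Z.
Proof.
have [cq cq'] := (S3_base_constc q, S3_base_constc (conjc q)).
rewrite /S3_of /= (S3_eval_twist _ cq'); last first.
  by rewrite rmorphM S3_base_const S3_base_Zs mulr_algl S3_WZs -scalerAl.
rewrite -scalerA S3_evalZ (S3_eval_twist _ cq); last first.
  by rewrite rmorphM S3_base_const S3_base_Zs mulr_algl S3_WsZs -scalerAl.
rewrite S3_base_Zs mulrDl -!mulrA S3_WsZs; congr (_ + _).
by rewrite S3_base_const mulr_algl -!scalerAr.
Qed.

Lemma S3_of_act s t v :
  S3_of (s3_act s t v) =
  S3_of v * (if s then star (s3_pi theta t) else s3_pi theta t).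
Proof.
elim: t s v => [||c|t IHt u IHu|t IHt u IHu|t IHt] s v; cbn [s3_act].
- by case: s; rewrite ?S3_of_mulZ ?S3_of_mulZs.
- by case: s; rewrite ?S3_of_mulW ?S3_of_mulWs.
- rewrite S3_ofZ S3_base_const s3_piC central_alg.
  by case: s; rewrite ?starZ ?star1.
- by rewrite S3_ofD IHt IHu s3_piD; case: s; rewrite ?starD mulrDr.
- by case: s; rewrite s3_piM ?starM ?IHt ?IHu ?IHt mulrA.
- by rewrite IHt s3_piS; case: s; rewrite /= ?starK.
Qed.

Definition S3_coef (x : S) : V := s3_act false (s3_repr x) (1, 0).

Lemma S3_coef_pi t : S3_coef (s3_pi theta t) = s3_act false t (1, 0).
Proof. by apply: s3_act_rel; apply: s3_repr_rel. Qed.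

(** Evaluation is equivariant and maps (1, 0) to 1, so an element is
    recovered from its normal form. *)
Lemma S3_coefK x : S3_of (S3_coef x) = x.
Proof.
rewrite /S3_coef S3_of_act s3_reprK /S3_of /= S3_eval0 mul0r addr0.
by rewrite S3_evalC rmorph1 mul1r.
Qed.

Lemma scale_pair_eq0 (b : B) (v : V) : b != 0 -> b *: v = 0 -> v = 0.
Proof.
move=> b0; have b0P (p : {poly B}) : b *: p = 0 -> p = 0.
  by rewrite -mul_polyC => /eqP; rewrite mulf_eq0 polyC_eq0 (negPf b0) => /eqP.
move=> bv; case: v bv => p r bv; congr pair.
  exact: b0P (congr1 fst bv).
exact: b0P (congr1 snd bv).
Qed.

Lemma S3_coef_regular (b : B) (a x : S) : b != 0 ->
  S3_coef (x * a) = b *: S3_coef x -> x * a = 0 -> x = 0.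
Proof.
move=> b0 + xa0; rewrite xa0.
have -> : S3_coef 0 = 0.
  by rewrite -[0 in LHS](scale0r (1 : S)) -s3_piC S3_coef_pi /= bconst0 scale0r.
move=> /esym /(scale_pair_eq0 b0) x0.
by rewrite -[x]S3_coefK x0 /S3_of /= !S3_eval0 mul0r addr0.
Qed.

Lemma S3_coef_Z2 x : S3_coef (x * S3_Z2 theta) = (bZ * bZs) *: S3_coef x.
Proof.
elim/s3_ind: x => t.
have -> : s3_pi theta t * S3_Z2 theta =
    s3_pi theta (TMul t (TMul TZ (TStar TZ))).
  by rewrite !s3_piM s3_piS.
rewrite !S3_coef_pi /=.
by rewrite op_twistK; [rewrite [bZs * bZ]mulrC | exact: bconst_qK'].
Qed.

Lemma S3_coef_W2 x : S3_coef (x * S3_W2 theta) = bW2 *: S3_coef x.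
Proof.
elim/s3_ind: x => t.
have -> : s3_pi theta t * S3_W2 theta =
    s3_pi theta (TMul t (TMul TW (TStar TW))).
  by rewrite !s3_piM s3_piS.
by rewrite !S3_coef_pi /= op_upK.
Qed.

Lemma S3_Z2_regular x : x * S3_Z2 theta = 0 -> x = 0.
Proof.
apply: S3_coef_regular (S3_coef_Z2 x).
by rewrite mulf_neq0 ?polyC_eq0 ?polyX_eq0.
Qed.

Lemma S3_W2_regular x : x * S3_W2 theta = 0 -> x = 0.
Proof.
apply: S3_coef_regular (S3_coef_W2 x).
exact: one_sub_MX_neq0.
Qed.
End Regular.

(** * Uniqueness of the connection *)

Section MetricUniqueness.
Variables (R : rcfType) (A : starAlgType R) (M : lmodType A^c).
Variables (h : M -> M -> A) (g : herm_lie A) (phi : lie_elt g -> M).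

Lemma addrr_eq0 (x : A) : x + x = 0 -> x = 0.
Proof.
move=> xx; have : (2 : R[i])^-1 *: (x + x) = x.
  by rewrite -[x + x]mulr2n -[x *+ 2]scaler_nat scalerA mulVf ?pnatr_eq0 // scale1r.
by rewrite xx scaler0.
Qed.

Lemma metric_ext (U : M) : real_metric_calculus h phi ->
  (forall e, h U (phi e) = 0) -> U = 0.
Proof.
case=> [[[hD hZ hS] hnd] _ gen _] Ue; apply: hnd => V.
have [n [e [a ->]]] := gen V.
rewrite (morph_sum (f := h U)) => [|v w]; last exact: hD.
by rewrite big1 // => k _; rewrite hZ Ue mul0r.
Qed.

Lemma hermitian_formBl (U V W : M) : hermitian_form h ->
  h (U - V) W = h U W - h V W.
Proof.
case=> hD hZ hS; apply: (addIr (h V W)); rewrite subrK.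
by rewrite -!(hS W) -starD -hD subrK.
Qed.

(** A real metric calculus carries at most one metric and torsion-free
    connection, by the Koszul argument applied to the difference of two. *)
Lemma pseudo_riemannian_unique (nabla nabla' : lie_elt g -> M -> M) :
  pseudo_riemannian_calculus h phi nabla ->
  pseudo_riemannian_calculus h phi nabla' -> nabla = nabla'.
Proof.
case=> rmc [nD _ nZ] nherm nmet ntor [_ [nD' _ nZ'] nherm' nmet' ntor'].
have hform : hermitian_form h by case: rmc => -[].
have hS : forall U V, star (h U V) = h V U by case: hform.
pose D d e := nabla d (phi e) - nabla' d (phi e).
pose T d e f := h (D d e) (phi f).
have Dsym d e : D d e = D e d.
  have nE (n : lie_elt g -> M -> M) :
      n d (phi e) - n e (phi d) - phi (lie_bracket d e) = 0 ->
      n d (phi e) = n e (phi d) + phi (lie_bracket d e).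
    by move/eqP; rewrite subr_eq0 subr_eq addrC => /eqP.
  by rewrite /D (nE _ (ntor d e)) (nE _ (ntor' d e)) opprD addrACA subrr addr0.
have Tanti d e f : T d e f = - T d f e.
  have mE (n : lie_elt g -> M -> M) :
      (forall e f, Defs.hermitian (h (n d (phi e)) (phi f))) ->
      (forall U V, proj1_sig d (h U V) = h (n d U) V + h U (n d V)) ->
      h (n d (phi e)) (phi f) =
      proj1_sig d (h (phi e) (phi f)) - h (n d (phi f)) (phi e).
    by move=> nh nm; rewrite nm -[h (phi e) _]hS nh addrK.
  rewrite /T /D !hermitian_formBl // (mE _ (nherm d) (nmet d)).
  rewrite (mE _ (nherm' d) (nmet' d)).
  by rewrite !opprB addrC addrA subrK.
have T0 d e f : T d e f = 0.
  apply: addrr_eq0; apply/eqP; rewrite -[X in _ + X]opprK subr_eq0; apply/eqP.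
  have Tsym d' e' f' : T d' e' f' = T e' d' f' by rewrite /T Dsym.
  (* going around the six permutations of (d, e, f) reverses the sign *)
  by rewrite [LHS]Tanti Tsym Tanti opprK Tsym Tanti Tsym.
have nE d e : nabla d (phi e) = nabla' d (phi e).
  by apply/subr0_eq/metric_ext => // f; apply: T0.
apply/funext => d; apply/funext => U; have [_ _ gen _] := rmc.
have [n [e [a ->]]] := gen U.
rewrite (morph_sum _ (nD d)) (morph_sum _ (nD' d)).
by apply: eq_bigr => k _; rewrite nZ nZ' nE.
Qed.
End MetricUniqueness.

(** * Linear independence of the generators; coordinates *)

(** The matrix with rows (-y, x w) and (x, y w) is invertible up to
    t = x^2 + y^2: multiplying by the transposed rotation isolates u and w v. *)
Lemma rotation_kernel (A : nzRingType) (x y t w u v : A) :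
  x * y = y * x -> x * x + y * y = t ->
  - y * u + x * w * v = 0 -> x * u + y * w * v = 0 ->
  t * u = 0 /\ t * (w * v) = 0.
Proof.
move=> xy <- e0 e1; split.
  have -> : (x * x + y * y) * u = x * (x * u + y * w * v) - y * (- y * u + x * w * v).
    rewrite !mulrDr mulrDl !mulrA mulrN !mulNr opprD opprK xy.
    by rewrite addrACA subrr addr0.
  by rewrite e0 e1 !mulr0 subr0.
have -> : (x * x + y * y) * (w * v) = x * (- y * u + x * w * v) + y * (x * u + y * w * v).
  rewrite !mulrDr mulrDl !mulrA mulrN !mulNr xy.
  by rewrite addrACA addNr add0r.
by rewrite e0 e1 !mulr0 addr0.
Qed.

Section Coordinates.
Variables (R : realType) (theta : R).
Local Notation S := (S3 theta).
Local Notation Z := (S3_Z theta).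
Local Notation W := (S3_W theta).
Local Notation Z2 := (S3_Z2 theta).
Local Notation W2 := (S3_W2 theta).
Local Notation M := (S3_M theta).
Local Notation E := (S3_E theta).

Section NormalElement.
Variable (A : starAlgType R) (x : A).
Hypothesis normal_x : star x * x = x * star x.
Let re := (2 : R[i])^-1 *: (x + star x).
Let im := (2 * 'i%C : R[i])^-1 *: (x - star x).

Lemma re_im_comm : re * im = im * re.
Proof.
rewrite /re /im -!scalerAl -!scalerAr !scalerA mulrC; congr (_ *: _).
have xC : GRing.comm x (star x) by apply/commr_sym.
apply: commrB; apply/commr_sym; apply: commrD => //; exact: commr_sym.
Qed.

Lemma re2_im2 : re * re + im * im = x * star x.
Proof.
have i2 : (2 * 'i%C : R[i])^-1 * (2 * 'i%C)^-1 = - (2^-1 * 2^-1).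
  by rewrite -!invfM mulrACA -[X in _ * X]expr2 sqr_i mulrN1 invrN.
rewrite /re /im -!scalerAl -!scalerAr !scalerA i2 scaleNr -scalerBr.
have -> : (x + star x) * (x + star x) - (x - star x) * (x - star x) = (x * star x) *+ 4.
  rewrite !mulrDl !mulrDr !mulrN !mulNr opprK normal_x.
  set p := x * star x; set a := x * x; set b := star x * star x.
  have -> : a + p + (p + b) - (a - p + (- p + b)) = p + p + (p + p).
    rewrite opprD addrACA opprB opprD opprK [p + b + _]addrACA subrr addr0.
    by rewrite [a + p + _]addrC [p - a + _]addrA subrK.
  by rewrite !mulrS mulr0n addr0 !addrA.
by rewrite -[_ *+ 4]scaler_nat scalerA -invfM -natrM mulVf ?scale1r ?pnatr_eq0.
Qed.
End NormalElement.

Lemma S3_X12 : S3_X1 theta * S3_X2 theta = S3_X2 theta * S3_X1 theta.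
Proof. exact: re_im_comm (S3_ZsZ theta). Qed.
Lemma S3_X34 : S3_X3 theta * S3_X4 theta = S3_X4 theta * S3_X3 theta.
Proof. exact: re_im_comm (S3_WsW theta). Qed.
Lemma S3_X12sq : S3_X1 theta * S3_X1 theta + S3_X2 theta * S3_X2 theta = Z2.
Proof. exact: re2_im2 (S3_ZsZ theta). Qed.
Lemma S3_X34sq : S3_X3 theta * S3_X3 theta + S3_X4 theta * S3_X4 theta = W2.
Proof. exact: re2_im2 (S3_WsW theta). Qed.

(** The first two components of E_1 u_1 + E_2 u_2 + E_3 u_3 involve u_1, u_3
    only and give |Z|^2 u_1 = |Z|^2 |W|^2 u_3 = 0; with u_3 = 0 the last two give
    |W|^2 u_2 = 0. *)
Lemma S3_vec_free (u : 'I_3 -> S) :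
  \sum_(a < 3) S3_vec theta a *r u a = 0 -> forall a, u a = 0.
Proof.
move=> u0.
have entry (j : 'I_4) := congr1 (fun v : 'rV[S^c]_4 => v ord0 j) u0.
have e0 := entry (@Ordinal 4 0 isT).
have e1 := entry (@Ordinal 4 1 isT).
have e2 := entry (@Ordinal 4 2 isT).
have e3 := entry (@Ordinal 4 3 isT).
move: e0 e1 e2 e3; rewrite !big_ord_recl !big_ord0 !mxE /=.
set u0' := u _; set u1 := u _; set u2 := u _.
rewrite !mulr0 !addr0 !add0r => e0 e1 e2 e3.
have [zu0 zwu2] := rotation_kernel S3_X12 S3_X12sq e0 e1.
have u20 : u2 = 0.
  apply: (S3_W2_regular (theta := theta)); rewrite -central_W2.
  by apply: (S3_Z2_regular (theta := theta)); rewrite -central_Z2.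
have u00 : u0' = 0 by apply: (S3_Z2_regular (theta := theta)); rewrite -central_Z2.
have e2' : - S3_X4 theta * u1 + S3_X3 theta * - Z2 * u2 = 0 by rewrite mulrN; exact: e2.
have e3' : S3_X3 theta * u1 + S3_X4 theta * - Z2 * u2 = 0 by rewrite mulrN; exact: e3.
have [wu1 _] := rotation_kernel (w := - Z2) (v := u2) S3_X34 S3_X34sq e2' e3'.
have u10 : u1 = 0 by apply: (S3_W2_regular (theta := theta)); rewrite -central_W2.
move=> [[|[|[|//]]] a_lt].
- by rewrite -[RHS]u00; congr u; apply: val_inj.
- by rewrite -[RHS]u10; congr u; apply: val_inj.
- by rewrite -[RHS]u20; congr u; apply: val_inj.
Qed.

Lemma S3_val_sum (u : 'I_3 -> S) :
  S3_M_val (\sum_(a < 3) E a *r u a) = \sum_(a < 3) S3_vec theta a *r u a.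
Proof. exact: (morph_sum (f := @S3_M_val R theta)). Qed.

Lemma S3_coord_ex (U : M) : exists u : 'I_3 -> S, U = \sum_(a < 3) E a *r u a.
Proof.
case: U => v vP; have /asboolP [u vu] := vP.
by exists u; apply: val_inj; rewrite /= S3_val_sum vu.
Qed.

Lemma S3_E_free (u u' : 'I_3 -> S) :
  \sum_(a < 3) E a *r u a = \sum_(a < 3) E a *r u' a -> u =1 u'.
Proof.
move/(congr1 (@S3_M_val R theta)); rewrite !S3_val_sum => /eqP.
rewrite -subr_eq0 -sumrB => /eqP uu.
move=> a; apply/eqP; rewrite -subr_eq0; apply/eqP; move: a.
apply: S3_vec_free; rewrite -[RHS]uu; apply: eq_bigr => a _.
exact: scalerBl.
Qed.

Lemma S3_coordK (U : M) : U = \sum_(a < 3) E a *r S3_coord U a.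
Proof.
rewrite /S3_coord; case: xgetP => [u -> //|nou].
have [u Uu] := S3_coord_ex U; case: (nou (finfun u)) => /=.
by rewrite {1}Uu; apply: eq_bigr => a _; rewrite ffunE.
Qed.

Lemma S3_coordE (u : 'I_3 -> S) : S3_coord (\sum_(a < 3) E a *r u a) =1 u.
Proof. by apply: S3_E_free; rewrite -S3_coordK. Qed.

Lemma S3_coord_inj (U V : M) : S3_coord U =1 S3_coord V -> U = V.
Proof.
by move=> UV; rewrite (S3_coordK U) (S3_coordK V); apply: eq_bigr => a _; rewrite UV.
Qed.

Lemma S3_coordD (U V : M) a : S3_coord (U + V) a = S3_coord U a + S3_coord V a.
Proof.
rewrite {1}(S3_coordK U) {1}(S3_coordK V) -big_split.
rewrite -[RHS](S3_coordE (fun a => S3_coord U a + S3_coord V a)).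
congr (S3_coord _ a); apply: eq_bigr => b _; exact/esym/scalerDl.
Qed.

Lemma S3_coord_ract (U : M) (x : S) a : S3_coord (U *r x) a = S3_coord U a * x.
Proof.
rewrite {1}(S3_coordK U) -[RHS](S3_coordE (fun a => S3_coord U a * x)).
rewrite /ract scaler_sumr; congr (S3_coord _ a).
by apply: eq_bigr => b _; apply: scalerA.
Qed.

Lemma S3_coord_E a b : S3_coord (E a) b = (a == b)%:R.
Proof.
rewrite -[RHS](S3_coordE (fun b => (a == b)%:R)); congr (S3_coord _ b).
rewrite (bigD1 a) //= eqxx big1 ?addr0 => [|c /negPf ca]; first exact/esym/scale1r.
by rewrite eq_sym ca; apply: scale0r.
Qed.

Lemma S3_coord0 a : S3_coord (0 : M) a = 0.
Proof. by apply: (addrI (S3_coord (0 : M) a)); rewrite -S3_coordD !addr0. Qed.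
Lemma S3_coordN (U : M) a : S3_coord (- U) a = - S3_coord U a.
Proof. by apply: (addrI (S3_coord U a)); rewrite -S3_coordD !subrr S3_coord0. Qed.

Definition S3_hdiag (a : 'I_3) : S := S3_hmat theta a a.

Lemma S3_hE (U V : M) :
  S3_h U V = \sum_(a < 3) star (S3_coord U a) * S3_hdiag a * S3_coord V a.
Proof.
apply: eq_bigr => a _; rewrite (bigD1 a) //= big1 ?addr0 // => b /negPf ba.
by rewrite /S3_hmat eq_sym ba mulr0 mul0r.
Qed.
End Coordinates.

(** * The Lie algebra and its real coordinates *)

Section Derivations.
Variables (R : rcfType) (A : starAlgType R) (d : A -> A).
Hypothesis dP : derivation d.

Lemma der_scaleD (c : R[i]) a b : d (c *: a + b) = c *: d a + d b.
Proof. by case: dP. Qed.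
Lemma derM a b : d (a * b) = d a * b + a * d b.
Proof. by case: dP. Qed.
Lemma derD a b : d (a + b) = d a + d b.
Proof. by have := der_scaleD 1 a b; rewrite !scale1r. Qed.
Lemma der0 : d 0 = 0.
Proof. by apply: (addrI (d 0)); rewrite -derD !addr0. Qed.
Lemma derZ (c : R[i]) a : d (c *: a) = c *: d a.
Proof. by rewrite -[c *: a]addr0 der_scaleD der0 addr0. Qed.
Lemma derN a : d (- a) = - d a.
Proof. by rewrite -scaleN1r derZ scaleN1r. Qed.
Lemma derB a b : d (a - b) = d a - d b.
Proof. by rewrite derD derN. Qed.
Lemma der1 : d 1 = 0.
Proof. by apply: (addrI (d 1)); have := derM 1 1; rewrite !mulr1 mul1r addr0. Qed.
Lemma der_alg (c : R[i]) : d c%:A = 0.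
Proof. by rewrite derZ der1 scaler0. Qed.
Lemma der_star a : hermitian_der d -> d (star a) = star (d a).
Proof. by move=> dh; rewrite -(dh a) starK. Qed.
End Derivations.

Section S3Derivations.
Variables (R : realType) (theta : R).
Local Notation S := (S3 theta).
Local Notation Z := (S3_Z theta).
Local Notation W := (S3_W theta).
Local Notation Z2 := (S3_Z2 theta).
Local Notation W2 := (S3_W2 theta).
Local Notation partial := (@S3_partial R theta).
Local Notation ii := (('i%C : R[i])%:A : S).

Lemma S3_der_ext (d d' : S -> S) :
  derivation d -> hermitian_der d -> derivation d' -> hermitian_der d' ->
  d Z = d' Z -> d W = d' W -> d =1 d'.
Proof.
move=> dP dh dP' dh' dZ dW; elim/s3_ind; elim=> [||c|t IHt u IHu|t IHt u IHu|t IHt] //.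
- by rewrite s3_piC (der_alg dP) (der_alg dP').
- by rewrite s3_piD (derD dP) (derD dP') IHt IHu.
- by rewrite s3_piM (derM dP) (derM dP') IHt IHu.
- by rewrite s3_piS (der_star _ dh) (der_star _ dh') IHt.
Qed.

Lemma S3_partial_0 : partial (inord 0) = @S3_partial1 R theta.
Proof. by rewrite /S3_partial inordK. Qed.
Lemma S3_partial_1 : partial (inord 1) = @S3_partial2 R theta.
Proof. by rewrite /S3_partial inordK. Qed.
Lemma S3_partial_2 : partial (inord 2) = @S3_partial3 R theta.
Proof. by rewrite /S3_partial inordK. Qed.

Lemma S3_partial_in a : S3_partials (partial a).
Proof.
elim/ord3_ind: a; rewrite ?S3_partial_0 ?S3_partial_1 ?S3_partial_2.
- exact: Or31.
- exact: Or32.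
- exact: Or33.
Qed.

Lemma S3_partial_der a : derivation (partial a).
Proof. by case: (S3_partialsP (S3_partial_in a)). Qed.
Lemma S3_partial_herm a : hermitian_der (partial a).
Proof. by case: (S3_partialsP (S3_partial_in a)). Qed.

(** The three derivations act diagonally on Z and W, with central eigenvalues
    that depend on the derivation. *)
Definition S3_rateZ (a : 'I_3) : S := [:: ii; 0; W2]`_a.
Definition S3_rateW (a : 'I_3) : S := [:: 0; ii; - Z2]`_a.

Lemma S3_partial_Z a : partial a Z = Z * S3_rateZ a.
Proof.
elim/ord3_ind: a; rewrite /S3_rateZ inordK //= ?S3_partial_0 ?S3_partial_1 ?S3_partial_2.
- by case: (S3_partial1P theta) => _ _ -> _; rewrite mulr_algr.
- by case: (S3_partial2P theta) => _ _ -> _; rewrite mulr0.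
- by case: (S3_partial3P theta) => _ _ -> _.
Qed.

Lemma S3_partial_W a : partial a W = W * S3_rateW a.
Proof.
elim/ord3_ind: a; rewrite /S3_rateW inordK //= ?S3_partial_0 ?S3_partial_1 ?S3_partial_2.
- by case: (S3_partial1P theta) => _ _ _ ->; rewrite mulr0.
- by case: (S3_partial2P theta) => _ _ _ ->; rewrite mulr_algr.
- by case: (S3_partial3P theta) => _ _ _ ->; rewrite mulrN.
Qed.

Lemma S3_rateZ_central a : central (S3_rateZ a).
Proof.
elim/ord3_ind: a; rewrite /S3_rateZ inordK //=; first exact: central_alg.
  exact: central0.
exact: central_W2.
Qed.

Lemma S3_rateW_central a : central (S3_rateW a).
Proof.
elim/ord3_ind: a; rewrite /S3_rateW inordK //=; first exact: central0.
  exact: central_alg.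
exact: central_NZ2.
Qed.

Lemma S3_partial_Z2 a : partial a Z2 = (Z2 * W2) *+ ((a == inord 2).*2).
Proof.
have cZ := @S3_rateZ_central a; have cZs := central_star cZ.
rewrite /S3_Z2 (derM (S3_partial_der a)) (der_star _ (S3_partial_herm a)) S3_partial_Z.
rewrite starM cZs -[X in X + _]mulrA cZ !(mulrA Z (star Z)) -mulrDr -/Z2.
clear cZ cZs.
elim/ord3_ind: a; rewrite /S3_rateZ inordK -?val_eqE /= ?inordK //=.
- by rewrite star_i subrr !mulr0.
- by rewrite star0 addr0 !mulr0.
- by rewrite S3_W2_herm mulrDr.
Qed.

Lemma S3_partial_W2 a : partial a W2 = - ((Z2 * W2) *+ ((a == inord 2).*2)).
Proof.
have dP := S3_partial_der a.
by rewrite -S3_partial_Z2 /S3_W2 S3_WWs (derB dP) (der1 dP) sub0r.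
Qed.

(** On the generators, commutation of two diagonal derivations amounts to this
    symmetry of the eigenvalues. *)
Lemma S3_partial_rate a b :
  partial a (S3_rateZ b) = partial b (S3_rateZ a) /\
  partial a (S3_rateW b) = partial b (S3_rateW a).
Proof.
have pd := S3_partial_der.
elim/ord3_ind: a; elim/ord3_ind: b; rewrite /S3_rateZ /S3_rateW !inordK //=;
rewrite ?(der0 (pd _)) ?(der_alg (pd _)) ?(derN (pd _)) ?S3_partial_Z2
  ?S3_partial_W2 -?val_eqE /= ?inordK //= ?mulr0n ?oppr0 //.
Qed.

Lemma S3_partialC a b x : partial a (partial b x) = partial b (partial a x).
Proof.
have [pd ph] := (S3_partial_der, S3_partial_herm).
apply/eqP; rewrite -subr_eq0; apply/eqP; move: x.
have [bd bh] := lie_gen_setP (@S3_partialsP R theta)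
  (LieBracket (LieGen (S3_partial_in a)) (LieGen (S3_partial_in b))).
have [zd zh] := lie_gen_setP (@S3_partialsP R theta) (LieZero _).
have [rZ rW] := S3_partial_rate a b.
apply: (S3_der_ext bd bh zd zh); rewrite /der_bracket;
  apply/eqP; rewrite subr_eq0; apply/eqP.
  rewrite !S3_partial_Z !(derM (pd _)) !S3_partial_Z rZ; congr (_ + _).
  by rewrite -!mulrA S3_rateZ_central.
rewrite !S3_partial_W !(derM (pd _)) !S3_partial_W rW; congr (_ + _).
by rewrite -!mulrA S3_rateW_central.
Qed.

Lemma S3_span_bracket (d d' : S -> S) (s s' : 'I_3 -> R) :
  (forall x, d x = \sum_(a < 3) ((s a)%:C)%C *: partial a x) ->
  (forall x, d' x = \sum_(a < 3) ((s' a)%:C)%C *: partial a x) ->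
  forall x, der_bracket d d' x = 0.
Proof.
move=> dE dE' x.
have pdl (r : 'I_3 -> R) a :
    partial a (\sum_(b < 3) ((r b)%:C)%C *: partial b x) =
    \sum_(b < 3) ((r b)%:C)%C *: partial a (partial b x).
  rewrite (morph_sum _ (derD (S3_partial_der a))).
  by apply: eq_bigr => b _; rewrite (derZ (S3_partial_der a)).
rewrite /der_bracket dE' [d' _]dE' dE [d x]dE.
under eq_bigr => a _ do rewrite pdl scaler_sumr.
under [X in _ - X]eq_bigr => a _ do rewrite pdl scaler_sumr.
rewrite [X in _ - X]exchange_big; apply/eqP; rewrite subr_eq0; apply/eqP.
apply: eq_bigr => a _; apply: eq_bigr => b _.
by rewrite !scalerA mulrC S3_partialC.
Qed.

(** The derivations commute, so brackets add nothing to their real span. *)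
Lemma S3_lie_span (d : S -> S) : S3_g theta d ->
  exists r : 'I_3 -> R, forall x, d x = \sum_(a < 3) ((r a)%:C)%C *: partial a x.
Proof.
elim=> {d} [d|||].
- move=> Sd; have [a ->] : exists a, d = partial a.
    case: Sd => ->; [exists (inord 0)|exists (inord 1)|exists (inord 2)];
    by rewrite ?S3_partial_0 ?S3_partial_1 ?S3_partial_2.
  exists (fun b => (b == a)%:R) => x; rewrite (bigD1 a) //= eqxx big1 ?addr0 ?scale1r //.
  by move=> b /negPf ->; rewrite scale0r.
- by exists (fun=> 0) => x; rewrite big1 // => a _; rewrite scale0r.
- move=> r d d' _ [s dE] _ [s' dE'].
  exists (fun a => r * s a + s' a) => x.
  rewrite /der_lin dE dE' scaler_sumr -big_split /=.
  by apply: eq_bigr => a _; rewrite scalerA -scalerDl rmorphD rmorphM.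
- move=> d d' _ [s dE] _ [s' dE'].
  exists (fun=> 0) => x; rewrite (S3_span_bracket dE dE') [RHS]big1 // => a _.
  exact: scale0r.
Qed.

Lemma S3_alg_eq0 (c : R[i]) : (c%:A : S) = 0 -> c = 0.
Proof. by move/eqP; rewrite scaler_eq0 oner_eq0 orbF => /eqP. Qed.

(** Comparing with the adjoint equation separates the skew-hermitian part ir
    from the hermitian part sy. *)
Lemma S3_imag_add_real (r s : R) (y : S) :
  star y = y -> (forall c : R[i], c *: y = 0 -> c = 0) ->
  (r%:C * 'i)%C%:A + (s%:C)%C *: y = 0 -> r = 0 /\ s = 0.
Proof.
move=> yh yreg e; have := congr1 star e; rewrite star0 starD !starZ star1 yh conjc_real.
have -> : conjc (r%:C * 'i)%C = - (r%:C * 'i)%C.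
  by apply/eqP; rewrite eq_complex /= !(mul0r, mulr0, subr0, addr0, oppr0) !eqxx.
rewrite scaleNr => e'; have r0 : (r%:C * 'i)%C%:A = 0 :> S.
  apply: addrr_eq0; rewrite -[RHS](subrr 0) -{1}e -e' opprD opprK.
  by rewrite addrACA subrr addr0.
have s0 : (s%:C)%C *: y = 0 by rewrite -e r0 add0r.
split; last by have /eqP := yreg _ s0; rewrite eq_complex /= => /andP[/eqP].
have /eqP := S3_alg_eq0 r0.
by rewrite eq_complex /= !(mul0r, mulr0, mulr1, subr0, addr0, add0r) => /andP[_ /eqP].
Qed.

Lemma S3_Z2_scale (c : R[i]) : c *: Z2 = 0 -> c = 0.
Proof. by rewrite -[c *: Z2]mulr_algl => /S3_Z2_regular/S3_alg_eq0. Qed.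
Lemma S3_W2_scale (c : R[i]) : c *: W2 = 0 -> c = 0.
Proof. by rewrite -[c *: W2]mulr_algl => /S3_W2_regular/S3_alg_eq0. Qed.

Lemma S3_rateZ_0 : S3_rateZ (inord 0) = ii. Proof. by rewrite /S3_rateZ inordK. Qed.
Lemma S3_rateZ_1 : S3_rateZ (inord 1) = 0. Proof. by rewrite /S3_rateZ inordK. Qed.
Lemma S3_rateZ_2 : S3_rateZ (inord 2) = W2. Proof. by rewrite /S3_rateZ inordK. Qed.
Lemma S3_rateW_0 : S3_rateW (inord 0) = 0. Proof. by rewrite /S3_rateW inordK. Qed.
Lemma S3_rateW_1 : S3_rateW (inord 1) = ii. Proof. by rewrite /S3_rateW inordK. Qed.
Lemma S3_rateW_2 : S3_rateW (inord 2) = - Z2. Proof. by rewrite /S3_rateW inordK. Qed.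

(** Evaluating a vanishing combination at Z and at W, and cancelling |Z|^2 and
    |W|^2, leaves i r_1 + r_3 |W|^2 = 0 and i r_2 - r_3 |Z|^2 = 0. *)
Lemma S3_partial_free (r : 'I_3 -> R) :
  (forall x : S, \sum_(a < 3) ((r a)%:C)%C *: partial a x = 0) -> forall a, r a = 0.
Proof.
move=> r0.
have [ZZ2 WW2] : star Z * Z = Z2 /\ star W * W = W2 by rewrite S3_ZsZ S3_WsW.
have factor (x : S) (f : 'I_3 -> S) :
    (forall a, partial a x = x * f a) ->
    \sum_(a < 3) ((r a)%:C)%C *: partial a x = x * \sum_(a < 3) ((r a)%:C)%C *: f a.
  by move=> xf; rewrite mulr_sumr; apply: eq_bigr => a _; rewrite xf scalerAr.
have eZ : ((r (inord 0))%:C%C * 'i%C)%:A + ((r (inord 2))%:C)%C *: W2 = 0.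
  apply: (S3_Z2_regular (theta := theta)); rewrite -central_Z2 -ZZ2 -mulrA.
  have := r0 Z; rewrite (factor _ _ S3_partial_Z) sum3 S3_rateZ_0 S3_rateZ_1 S3_rateZ_2.
  by rewrite scaler0 addr0 scalerA => ->; rewrite mulr0.
have eW : ((r (inord 1))%:C%C * 'i%C)%:A + ((- r (inord 2))%:C)%C *: Z2 = 0.
  apply: (S3_W2_regular (theta := theta)); rewrite -central_W2 -WW2 -mulrA.
  have := r0 W; rewrite (factor _ _ S3_partial_W) sum3 S3_rateW_0 S3_rateW_1 S3_rateW_2.
  by rewrite scaler0 add0r scalerA scalerN -scaleNr -rmorphN => ->; rewrite mulr0.
have [r00 r20] := S3_imag_add_real (S3_W2_herm theta) S3_W2_scale eZ.
have [r10 _] := S3_imag_add_real (S3_Z2_herm theta) S3_Z2_scale eW.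
exact: ord3_ind.
Qed.

Lemma S3_gcoordK (d : lie_elt (S3_g theta)) x :
  proj1_sig d x = \sum_(a < 3) ((S3_gcoord d a)%:C)%C *: partial a x.
Proof.
rewrite /S3_gcoord; case: xgetP => [r _ rE|nor]; first exact: rE.
have [r rE] := S3_lie_span (proj2_sig d); case: (nor (finfun r)) => y /=.
by rewrite rE; apply: eq_bigr => a _; rewrite ffunE.
Qed.

Lemma S3_gcoordE (d : lie_elt (S3_g theta)) (r : 'I_3 -> R) :
  (forall x, proj1_sig d x = \sum_(a < 3) ((r a)%:C)%C *: partial a x) ->
  S3_gcoord d =1 r.
Proof.
move=> dr a; apply/eqP; rewrite -subr_eq0; apply/eqP; move: a.
apply: S3_partial_free => x.
transitivity (proj1_sig d x - proj1_sig d x); last exact: subrr.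
rewrite {1}S3_gcoordK dr -sumrB; apply: eq_bigr => a _.
by rewrite rmorphB scalerBl.
Qed.

Lemma S3_gcoord_lin r (d d' : lie_elt (S3_g theta)) a :
  S3_gcoord (lie_lin r d d') a = r * S3_gcoord d a + S3_gcoord d' a.
Proof.
apply: (S3_gcoordE (r := fun a => r * S3_gcoord d a + S3_gcoord d' a)) => x /=.
rewrite /der_lin !S3_gcoordK scaler_sumr -big_split /=.
by apply: eq_bigr => b _; rewrite scalerA -scalerDl rmorphD rmorphM.
Qed.

Lemma S3_gcoord_bracket (d d' : lie_elt (S3_g theta)) a :
  S3_gcoord (lie_bracket d d') a = 0.
Proof.
apply: (S3_gcoordE (r := fun=> 0)) => x; rewrite big1 => [|b _]; last exact: scale0r.
exact: S3_span_bracket (S3_gcoordK d) (S3_gcoordK d') x.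
Qed.

Definition S3_d (a : 'I_3) : lie_elt (S3_g theta) :=
  exist (S3_g theta) (partial a) (LieGen (S3_partial_in a)).

Lemma S3_gcoord_partial (d : lie_elt (S3_g theta)) a :
  proj1_sig d = partial a -> forall b, S3_gcoord d b = (b == a)%:R.
Proof.
move=> dE; apply: (S3_gcoordE (r := fun b => (b == a)%:R)) => x.
rewrite dE (bigD1 a) //= eqxx big1 ?addr0 ?scale1r // => c /negPf ->.
exact: scale0r.
Qed.
End S3Derivations.

(** * The Levi-Civita connection *)

Section S3Geometry.
Variables (R : realType) (theta : R).
Local Notation S := (S3 theta).
Local Notation Z2 := (S3_Z2 theta).
Local Notation W2 := (S3_W2 theta).
Local Notation M := (S3_M theta).
Local Notation E := (S3_E theta).
Local Notation H := (S3_hdiag theta).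
Local Notation g := (lie_elt (S3_g theta)).
Local Notation partial := (@S3_partial R theta).
Local Notation coord := S3_coord.
Local Notation gcoord := S3_gcoord.

Definition central_herm (x : S) := central x /\ star x = x.

Lemma central_herm_add x y : central_herm x -> central_herm y -> central_herm (x + y).
Proof.
move=> [cx hx] [cy hy]; split=> [z|]; last by rewrite starD hx hy.
by rewrite mulrDl mulrDr cx cy.
Qed.
Lemma central_herm_opp x : central_herm x -> central_herm (- x).
Proof.
move=> [cx hx]; split=> [z|]; last by rewrite starN hx.
by rewrite mulNr mulrN cx.
Qed.
Lemma central_herm_mul x y : central_herm x -> central_herm y -> central_herm (x * y).
Proof.
move=> [cx hx] [cy hy]; split=> [z|]; last by rewrite starM hx hy cx.
by rewrite -mulrA cy mulrA cx mulrA.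
Qed.
Lemma central_herm_real (r : R) : central_herm (r%:C)%C%:A.
Proof. by split; [apply: central_alg | rewrite starZ star1 conjc_real]. Qed.
Lemma central_herm_scale (r : R) x :
  central_herm x -> central_herm ((r%:C)%C *: x).
Proof.
move=> xch; rewrite -[_ *: x]mulr_algl.
exact: central_herm_mul (central_herm_real r) xch.
Qed.
Lemma central_herm0 : central_herm 0.
Proof. by split; [apply: central0 | apply: star0]. Qed.
Lemma central_herm1 : central_herm 1.
Proof. by split=> [z|]; rewrite ?star1 // mulr1 mul1r. Qed.
Lemma central_herm_Z2 : central_herm Z2.
Proof. by split; [apply: central_Z2 | apply: S3_Z2_herm]. Qed.
Lemma central_herm_W2 : central_herm W2.
Proof. by split; [apply: central_W2 | apply: S3_W2_herm]. Qed.
Lemma central_herm_sum (n : nat) (F : 'I_n -> S) :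
  (forall k, central_herm (F k)) -> central_herm (\sum_(k < n) F k).
Proof.
by move=> Fch; elim/big_ind: _ => //; [exact: central_herm0|exact: central_herm_add].
Qed.
(** Differentiating the relation x y = y x shows that derivations preserve the
    centre. *)
Lemma central_herm_der (d : S -> S) x : derivation d -> hermitian_der d ->
  central_herm x -> central_herm (d x).
Proof.
move=> dP dh [cx hx]; split=> [y|]; last by rewrite -(der_star _ dh) hx.
have := congr1 d (cx y); rewrite !(derM dP) cx [d x * y + _]addrC.
exact: addrI.
Qed.
Lemma lie_elt_der (d : g) : derivation (proj1_sig d) /\ hermitian_der (proj1_sig d).
Proof. by case: d => d; apply: lie_setP. Qed.

Lemma S3_hdiag_0 : H (inord 0) = Z2.
Proof. by rewrite /S3_hdiag /S3_hmat eqxx inordK. Qed.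
Lemma S3_hdiag_1 : H (inord 1) = W2.
Proof. by rewrite /S3_hdiag /S3_hmat eqxx inordK. Qed.
Lemma S3_hdiag_2 : H (inord 2) = Z2 * W2.
Proof. by rewrite /S3_hdiag /S3_hmat eqxx inordK. Qed.

Lemma central_herm_hdiag a : central_herm (H a).
Proof.
elim/ord3_ind: a; rewrite ?S3_hdiag_0 ?S3_hdiag_1 ?S3_hdiag_2.
- exact: central_herm_Z2.
- exact: central_herm_W2.
- exact: central_herm_mul central_herm_Z2 central_herm_W2.
Qed.

Lemma S3_hdiag_regular a x : x * H a = 0 -> x = 0.
Proof.
elim/ord3_ind: a; rewrite ?S3_hdiag_0 ?S3_hdiag_1 ?S3_hdiag_2.
- exact: S3_Z2_regular.
- exact: S3_W2_regular.
- by rewrite mulrA => /S3_W2_regular/S3_Z2_regular.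
Qed.

Lemma S3_h_metric : is_metric (@S3_h R theta).
Proof.
have hform : hermitian_form (@S3_h R theta).
  split=> [U V V'|U V x|U V]; rewrite !S3_hE.
  - by rewrite -big_split; apply: eq_bigr => a _; rewrite S3_coordD mulrDr.
  - by rewrite mulr_suml; apply: eq_bigr => a _; rewrite S3_coord_ract mulrA.
  - rewrite (morph_sum _ (@starD _ S)); apply: eq_bigr => a _.
    by rewrite !starM starK (proj2 (central_herm_hdiag a)) mulrA.
split=> // U U0; apply: S3_coord_inj => a; rewrite S3_coord0.
have := U0 (E a); rewrite S3_hE (bigD1 a) //= big1 ?addr0 => [|b /negPf ba].
  rewrite S3_coord_E eqxx mulr1 => /S3_hdiag_regular u0.
  by rewrite -[coord U a]starK u0 star0.
by rewrite S3_coord_E eq_sym ba mulr0.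
Qed.

Lemma S3_coord_phi (d : g) a : coord (S3_phi d) a = ((gcoord d a)%:C)%C%:A.
Proof. exact: (S3_coordE (fun a => ((gcoord d a)%:C)%C%:A)). Qed.

Lemma S3_phi_real_linear : real_linear (@S3_phi R theta).
Proof.
move=> r d d'; apply: S3_coord_inj => a.
rewrite S3_coordD /rscale S3_coord_ract !S3_coord_phi S3_gcoord_lin mulr_algr.
by rewrite scalerA -scalerDl rmorphD rmorphM.
Qed.

Lemma S3_phi_d (d : g) a : proj1_sig d = partial a -> S3_phi d = E a.
Proof.
move=> dE; apply: S3_coord_inj => b.
rewrite S3_coord_phi (S3_gcoord_partial dE) S3_coord_E eq_sym.
by case: eqP; rewrite ?scale1r ?scale0r.
Qed.

Lemma S3_phi_generates : generates (@S3_phi R theta).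
Proof.
move=> U; exists 3, (S3_d theta), (coord U); rewrite {1}(S3_coordK U).
by apply: eq_bigr => a _; rewrite (@S3_phi_d (S3_d theta a) a).
Qed.

Lemma central_herm_h (U V : M) : (forall a, central_herm (coord U a)) ->
  (forall a, central_herm (coord V a)) -> central_herm (S3_h U V).
Proof.
move=> Uch Vch; rewrite S3_hE; apply: central_herm_sum => a.
rewrite (proj2 (Uch a)).
by apply: central_herm_mul (central_herm_mul _ (central_herm_hdiag a)) _.
Qed.

Lemma central_herm_phi (d : g) a : central_herm (coord (S3_phi d) a).
Proof. by rewrite S3_coord_phi; apply: central_herm_real. Qed.

Lemma S3_real_metric_calculus : real_metric_calculus (@S3_h R theta) (@S3_phi R theta).
Proof.
split; [exact: S3_h_metric|exact: S3_phi_real_linear|exact: S3_phi_generates|].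
by move=> d d'; case: (central_herm_h (central_herm_phi d) (central_herm_phi d')).
Qed.

(** The coefficient of E_c in nabla_a E_b. *)
Definition S3_christoffel (a b c : 'I_3) : S :=
  match nat_of_ord a, nat_of_ord b, nat_of_ord c with
  | 0%N, 0%N, 2%N => - 1
  | 0%N, 2%N, 0%N | 2%N, 0%N, 0%N => W2
  | 1%N, 1%N, 2%N => 1
  | 1%N, 2%N, 1%N | 2%N, 1%N, 1%N => - Z2
  | 2%N, 2%N, 2%N => W2 - Z2
  | _, _, _ => 0
  end.
Local Notation Gam := S3_christoffel.

Lemma central_herm_christoffel a b c : central_herm (Gam a b c).
Proof.
have [z w] := (central_herm_Z2, central_herm_W2).
rewrite /S3_christoffel; elim/ord3_ind: a; elim/ord3_ind: b; elim/ord3_ind: c;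
rewrite !inordK //;
by [exact: central_herm0 | exact: central_herm1
   | apply: central_herm_opp; exact: central_herm1 | exact: central_herm_opp
   | apply: central_herm_add => //; exact: central_herm_opp].
Qed.

Lemma S3_christoffel_sym a b c : Gam a b c = Gam b a c.
Proof.
rewrite /S3_christoffel.
by elim/ord3_ind: a; elim/ord3_ind: b; elim/ord3_ind: c; rewrite !inordK.
Qed.

(** Compatibility with the metric on the basis vectors. *)
Lemma S3_christoffel_metric a b c :
  partial a (H b) *+ (b == c) = Gam a b c * H c + H b * Gam a c b.
Proof.
have dH2 a' : partial a' (Z2 * W2) = partial a' Z2 * W2 + Z2 * partial a' W2.
  exact: derM (S3_partial_der theta a') _ _.
have zw : W2 * Z2 = Z2 * W2 by rewrite central_W2.
rewrite /S3_christoffel; elim/ord3_ind: a; elim/ord3_ind: b; elim/ord3_ind: c;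
rewrite -?val_eqE /= !inordK //= ?mulr0n ?mulr1n ?S3_hdiag_0 ?S3_hdiag_1 ?S3_hdiag_2
  ?dH2 ?S3_partial_Z2 ?S3_partial_W2 -?val_eqE /= ?inordK //=
  ?mulr0n ?oppr0 ?(mul0r, mulr0, addr0, mul1r, mulr1, mulN1r, mulrN1) //.
- by rewrite addNr.
- by rewrite zw subrr.
- by rewrite mulrN zw subrr.
- by rewrite mulNr addNr.
- by rewrite zw.
- by rewrite mulNr mulrN zw mulr2n opprD.
- have pc : central (Z2 * W2) by case: (central_herm_mul central_herm_Z2 central_herm_W2).
  by rewrite -(pc (W2 - Z2)) -mulr2n mulrN mulrnAr -pc mulrnAl -mulrnBl -mulrBr.
Qed.

Definition S3_nabla (d : g) (U : M) : M :=
  \sum_(c < 3) E c *r (proj1_sig d (coord U c) +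
    \sum_(a < 3) \sum_(b < 3) ((gcoord d a)%:C)%C *: (Gam a b c * coord U b)).

Lemma S3_coord_nabla d U c : coord (S3_nabla d U) c =
  proj1_sig d (coord U c) +
    \sum_(a < 3) \sum_(b < 3) ((gcoord d a)%:C)%C *: (Gam a b c * coord U b).
Proof. by rewrite S3_coordE. Qed.

Lemma S3_nabla_affine : affine_connection S3_nabla.
Proof.
split=> [d U V|r d d' U|d U x]; apply: S3_coord_inj => c.
- have [dP _] := lie_elt_der d.
  rewrite S3_coordD !S3_coord_nabla S3_coordD (derD dP) addrACA; congr (_ + _).
  rewrite -big_split; apply: eq_bigr => a _; rewrite -big_split; apply: eq_bigr => b _.
  by rewrite S3_coordD mulrDr scalerDr.
- rewrite S3_coordD /rscale S3_coord_ract !S3_coord_nabla /= /der_lin mulr_algr scalerDr.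
  rewrite addrACA; congr (_ + _).
  rewrite scaler_sumr -big_split; apply: eq_bigr => a _.
  rewrite scaler_sumr -big_split; apply: eq_bigr => b _ /=.
  by rewrite S3_gcoord_lin scalerA -scalerDl rmorphD rmorphM.
- have [dP _] := lie_elt_der d.
  rewrite S3_coordD !S3_coord_ract !S3_coord_nabla S3_coord_ract (derM dP).
  rewrite mulrDl addrAC; congr (_ + _ + _).
  rewrite mulr_suml; apply: eq_bigr => a _; rewrite mulr_suml; apply: eq_bigr => b _.
  by rewrite S3_coord_ract mulrA scalerAl.
Qed.

Lemma central_herm_nabla d U : (forall a, central_herm (coord U a)) ->
  forall c, central_herm (coord (S3_nabla d U) c).
Proof.
move=> Uch c; rewrite S3_coord_nabla; have [dP dh] := lie_elt_der d.
apply: central_herm_add; first exact: central_herm_der.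
apply: central_herm_sum => a; apply: central_herm_sum => b.
by apply/central_herm_scale/central_herm_mul => //; apply: central_herm_christoffel.
Qed.

Lemma S3_nabla_torsion (d1 d2 : g) :
  S3_nabla d1 (S3_phi d2) - S3_nabla d2 (S3_phi d1) - S3_phi (lie_bracket d1 d2) = 0.
Proof.
have [[dP _] [dP' _]] := (lie_elt_der d1, lie_elt_der d2).
apply: S3_coord_inj => c; rewrite !(S3_coordD, S3_coordN) !S3_coord_nabla.
rewrite !S3_coord_phi S3_gcoord_bracket scale0r subr0 S3_coord0.
rewrite (der_alg dP) (der_alg dP') !add0r.
apply/eqP; rewrite subr_eq0 exchange_big; apply/eqP.
apply: eq_bigr => a _; apply: eq_bigr => b _.
by rewrite !S3_coord_phi !mulr_algr !scalerA S3_christoffel_sym mulrC.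
Qed.

(** By the Leibniz rule the terms that differentiate the coordinates match; the
    others reduce to [S3_christoffel_metric] once the summation indices are
    renamed. *)
Lemma S3_nabla_metric (d : g) (U V : M) :
  proj1_sig d (S3_h U V) = S3_h (S3_nabla d U) V + S3_h U (S3_nabla d V).
Proof.
have [dP dh] := lie_elt_der d.
pose r a := ((gcoord d a)%:C)%C.
pose G (U : M) c := \sum_(a < 3) \sum_(b < 3) r a *: (Gam a b c * coord U b).
have GE U' c : coord (S3_nabla d U') c = proj1_sig d (coord U' c) + G U' c.
  exact: S3_coord_nabla.
have starr a : conjc (r a) = r a by rewrite conjc_real.
rewrite !S3_hE (morph_sum _ (derD dP)) -big_split.
have -> : \sum_(c < 3) proj1_sig d (star (coord U c) * H c * coord V c) =
   \sum_(c < 3) (star (proj1_sig d (coord U c)) * H c * coord V c +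
                 star (coord U c) * H c * proj1_sig d (coord V c)) +
   \sum_(b < 3) star (coord U b) * proj1_sig d (H b) * coord V b.
  rewrite -big_split; apply: eq_bigr => c _.
  by rewrite !(derM dP) (der_star _ dh) mulrDl addrAC.
transitivity (\sum_(c < 3) (star (proj1_sig d (coord U c)) * H c * coord V c +
                 star (coord U c) * H c * proj1_sig d (coord V c)) +
  \sum_(c < 3) (star (G U c) * H c * coord V c +
                 star (coord U c) * H c * G V c)); last first.
  rewrite -big_split; apply: eq_bigr => c _ /=.
  by rewrite !GE starD !(mulrDl, mulrDr) addrACA.
congr (_ + _); rewrite big_split /=.
pose T b c a := r a *: (star (coord U b) * (Gam a b c * H c) * coord V c).
pose T' b c a := r a *: (star (coord U b) * (H b * Gam a c b) * coord V c).
have -> : \sum_(c < 3) star (G U c) * H c * coord V c =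
    \sum_(c < 3) \sum_(a < 3) \sum_(b < 3) T b c a.
  apply: eq_bigr => c _; rewrite (morph_sum _ (@starD _ S)) !mulr_suml.
  apply: eq_bigr => a _; rewrite (morph_sum _ (@starD _ S)) !mulr_suml.
  apply: eq_bigr => b _; rewrite starZ starM starr.
  rewrite (proj2 (central_herm_christoffel a b c)).
  by rewrite /T -!scalerAl !mulrA.
have -> : \sum_(c < 3) star (coord U c) * H c * G V c =
    \sum_(b < 3) \sum_(a < 3) \sum_(c < 3) T' b c a.
  apply: eq_bigr => b _; rewrite mulr_sumr; apply: eq_bigr => a _.
  rewrite mulr_sumr; apply: eq_bigr => c _.
  by rewrite /T' -scalerAr !mulrA.
have -> : \sum_(c < 3) \sum_(a < 3) \sum_(b < 3) T b c a =
    \sum_(b < 3) \sum_(a < 3) \sum_(c < 3) T b c a.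
  rewrite exchange_big; under eq_bigr => a _ do rewrite exchange_big.
  exact: exchange_big.
rewrite -big_split; apply: eq_bigr => b _ /=.
rewrite -big_split S3_gcoordK mulr_sumr mulr_suml; apply: eq_bigr => a _ /=.
rewrite -big_split /= (eq_bigr (fun c => r a *: (star (coord U b) *
    (partial a (H b) *+ (b == c)) * coord V c))); last first.
  by move=> c _; rewrite S3_christoffel_metric /T /T' -scalerDr mulrDr mulrDl.
rewrite (bigD1 b) //= eqxx mulr1n big1 ?addr0 => [|c /negPf cb].
  by rewrite -scalerAr -scalerAl.
by rewrite eq_sym cb mulr0n mulr0 mul0r scaler0.
Qed.

Lemma S3_nabla_levi_civita :
  real_pseudo_riemannian_calculus (@S3_h R theta) (@S3_phi R theta) S3_nabla.
Proof.
split; last first.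
  move=> d1 d2 e e'.
  have := central_herm_nabla d1 (central_herm_nabla d2 (central_herm_phi e)).
  by move/central_herm_h => /(_ _ (central_herm_phi e')) [].
split.
- exact: S3_real_metric_calculus.
- exact: S3_nabla_affine.
- move=> d e e'; have := central_herm_nabla d (central_herm_phi e).
  by move/central_herm_h => /(_ _ (central_herm_phi e')) [].
- exact: S3_nabla_metric.
- exact: S3_nabla_torsion.
Qed.

Lemma S3_coord_nabla_E (d : g) a b c : proj1_sig d = partial a ->
  coord (S3_nabla d (E b)) c = Gam a b c.
Proof.
move=> dE; have [dP _] := lie_elt_der d; rewrite S3_coord_nabla S3_coord_E.
rewrite (_ : proj1_sig d _ = 0) ?add0r; last first.
  by case: (b == c); rewrite /= ?(der1 dP) ?(der0 dP).
rewrite (bigD1 a) //= [X in _ + X]big1 ?addr0 => [|a' /negPf a'a]; last first.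
  by rewrite big1 // => b' _; rewrite (S3_gcoord_partial dE) a'a scale0r.
rewrite (bigD1 b) //= big1 ?addr0 => [|b' /negPf b'b].
  by rewrite (S3_gcoord_partial dE) S3_coord_E !eqxx mulr1 scale1r.
by rewrite S3_coord_E eq_sym b'b mulr0 scaler0.
Qed.
End S3Geometry.

Theorem proposition6p5 (R : realType) (theta : R) :
  (exists! nabla : lie_elt (S3_g theta) -> S3_M theta -> S3_M theta,
     real_pseudo_riemannian_calculus (@S3_h R theta) (@S3_phi R theta) nabla) /\
  (forall nabla : lie_elt (S3_g theta) -> S3_M theta -> S3_M theta,
     real_pseudo_riemannian_calculus (@S3_h R theta) (@S3_phi R theta) nabla ->
     let E1 := S3_E1 theta in let E2 := S3_E2 theta in let E3 := S3_E3 theta in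
     let Zsq := S3_Z2 theta in let Wsq := S3_W2 theta in
     [/\ [/\ nabla (S3_d1 theta) E1 = - E3,
             nabla (S3_d1 theta) E2 = 0
           & nabla (S3_d1 theta) E3 = E1 *r Wsq],
         [/\ nabla (S3_d2 theta) E1 = 0,
             nabla (S3_d2 theta) E2 = E3
           & nabla (S3_d2 theta) E3 = - (E2 *r Zsq)]
       & [/\ nabla (S3_d3 theta) E1 = E1 *r Wsq,
             nabla (S3_d3 theta) E2 = - (E2 *r Zsq)
           & nabla (S3_d3 theta) E3 = E3 *r (Wsq - Zsq)]]).
Proof.
have nablaP := S3_nabla_levi_civita theta.
have uniq nabla :
    real_pseudo_riemannian_calculus (@S3_h R theta) (@S3_phi R theta) nabla ->
    nabla = @S3_nabla R theta.
  by move=> [np _]; apply: pseudo_riemannian_unique np (proj1 nablaP).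
split; first by exists (@S3_nabla R theta); split=> // nabla /uniq.
move=> nabla /uniq -> E1 E2 E3 Zsq Wsq.
have d1 : proj1_sig (S3_d1 theta) = S3_partial (inord 0) by rewrite S3_partial_0.
have d2 : proj1_sig (S3_d2 theta) = S3_partial (inord 1) by rewrite S3_partial_1.
have d3 : proj1_sig (S3_d3 theta) = S3_partial (inord 2) by rewrite S3_partial_2.
split; split; apply: S3_coord_inj => c;
  rewrite (S3_coord_nabla_E _ _ d1, S3_coord_nabla_E _ _ d2, S3_coord_nabla_E _ _ d3)
  ?S3_coordN ?S3_coord_ract ?S3_coord0 ?S3_coord_E; elim/ord3_ind: c;
  rewrite /S3_christoffel -?val_eqE /= !inordK //= ?mul1r ?mul0r ?oppr0;
  by [].
Qed.
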